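(* Let $\Phi$ be an irreducible root system of rank $\ell$ with Coxeter number $h$, and let $n\geq0$ be an integer with $\gcd(n+1,\rho)=1$. Then \[ \chi_{quasi}(\mathcal{A}_{\Phi}^{[1,n]},t)=\Big(\prod_{j=0}^{\ell}\frac{1}{n+1}[n+1]_{\mathrm{S}^{c_j}}\Big)t^{\ell}. \] In particular, the characteristic quasi-polynomial is a polynomial, and every root $z\in\mathbb{C}$ of the equation $\chi(\mathcal{A}_{\Phi}^{[1,n]},t)=0$ satisfies $\operatorname{Re} z=\frac{nh}{2}$.
   Context: Root system data: $\Phi\subset V=\mathbb{R}^\ell$ is an irreducible crystallographic root system with positive system $\Phi^+$, simple roots $\alpha_1,\dots,\alpha_\ell$, highest root $\tilde\alpha=\sum_{i=1}^\ell c_i\alpha_i$, $c_0:=1$; the Coxeter number satisfies $h=c_0+c_1+\dots+c_\ell$. $Z(\Phi)=\{x\in V:(\alpha_i,x)\in\mathbb{Z}\ \forall i\}$. A quasi-polynomial is a function $\mathbb{Z}\to\mathbb{C}$ agreeing with a polynomial on each residue class modulo some positive integer (a period). $\rho$ is the minimal period of the Ehrhart quasi-polynomial of the closed fundamental alcove, $\mathrm{L}_\Phi(q)=\#\{x\in Z(\Phi):(\alpha_i,x)\ge0\ (1\le i\le\ell),\ (\tilde\alpha,x)\le q\}$. $[c]_x:=1+x+\dots+x^{c-1}$; $\mathrm{S}$ is the shift operator $(\mathrm{S}g)(t)=g(t-1)$, extended to polynomials in $\mathrm{S}$ linearly. Linial arrangement $\mathcal{A}_\Phi^{[1,n]}=\{H_{\alpha,k}:\alpha\in\Phi^+,1\le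 k\le n\}$, $H_{\alpha,k}=\{x\in V:(\alpha,x)=k\}$ (empty if $n=0$). Its characteristic polynomial is $\chi(\mathcal{A},t)=\sum_{\mathcal{B}\subseteq\mathcal{A},\ \cap\mathcal{B}\ne\emptyset}(-1)^{|\mathcal{B}|}t^{\dim\cap\mathcal{B}}$. Its characteristic quasi-polynomial $\chi_{quasi}(\mathcal{A}_\Phi^{[1,n]},t)$ is the quasi-polynomial equal, for all sufficiently large positive integers $q$, to $\#\{x\in Z(\Phi)/qZ(\Phi):(\alpha,x)\not\equiv k\bmod q\ \forall\alpha\in\Phi^+,1\le k\le n\}$. (Known fact: $\chi_{quasi}(\mathcal{A}_\Phi^{[1,n]},q)=\chi(\mathcal{A}_\Phi^{[1,n]},q)$ for $q\equiv1\bmod\rho$.) *)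

(* Defs.v *)
From HB Require Import structures.
From mathcomp Require Import all_boot all_order all_algebra finmap.
From mathcomp Require Import boolp classical_sets functions cardinality reals.
From mathcomp Require Import complex.

Set Implicit Arguments.
Unset Strict Implicit.
Unset Printing Implicit Defensive.

Import Order.TTheory GRing.Theory Num.Theory.

Local Open Scope classical_set_scope.
Local Open Scope fset_scope.
Local Open Scope ring_scope.

Section RootSystems.
Variables (R : realType) (l : nat).
Local Notation V := 'rV[R]_l.
Implicit Types (Phi : {fset V}) (alpha : 'I_l -> V) (c : 'I_l -> nat).

Definition dot (u v : V) : R := \sum_(i < l) u 0 i * v 0 i.

Definition refl (a x : V) : V := x - (2%:R * dot a x / dot a a) *: a.

Definition root_system Phi : Prop :=
  [/\ 0 \notin Phi,
      <<enum_fset Phi>>%VS = fullv,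
      forall a b, a \in Phi -> b \in Phi -> refl a b \in Phi,
      forall a b, a \in Phi -> b \in Phi ->
        2%:R * dot a b / dot a a \is a Num.int
    & forall a (x : R), a \in Phi -> x *: a \in Phi -> x = 1 \/ x = -1].

Definition irreducible_root_system Phi : Prop :=
  [/\ root_system Phi, Phi != fset0
    & forall Psi, Psi `<=` Phi ->
        (forall a b, a \in Psi -> b \in Phi `\` Psi -> dot a b = 0) ->
        Psi = fset0 \/ Psi = Phi].

Definition nat_comb alpha (m : 'I_l -> nat) : V :=
  \sum_(i < l) (m i)%:R *: alpha i.

(* As there are l = dim V simple roots, freeness makes them a basis of V. *)
Definition simple_system Phi alpha : Prop :=
  [/\ forall i, alpha i \in Phi,
      free [tuple alpha i | i < l]
    & forall b, b \in Phi ->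
        exists m, b = nat_comb alpha m \/ b = - nat_comb alpha m].

Definition pos_roots Phi alpha : {fset V} :=
  [fset b in Phi | `[< exists m, b = nat_comb alpha m >]].

Definition highest_root Phi alpha (a : V) : Prop :=
  a \in Phi /\ forall b, b \in Phi -> exists m, a - b = nat_comb alpha m.

Definition ext_coef c (j : 'I_l.+1) : nat :=
  if unlift ord0 j is Some i then c i else 1%N.

(* The identity h = c_0 + c_1 + ... + c_l is taken as the definition of the
   Coxeter number. *)
Definition coxeter_number c : nat := (\sum_(j < l.+1) ext_coef c j)%N.

Definition coweight_lattice alpha : set V :=
  [set x | forall i, dot (alpha i) x \is a Num.int].

Definition ncard (T : choiceType) (A : set T) : nat := #|` fset_set A |.

End RootSystems.

Section QuasiPolynomials.
Variable R : realType.
Local Notation C := R[i].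
Implicit Type f : int -> C.

Definition has_period f (p : nat) : Prop :=
  (0 < p)%N /\ exists g : int -> {poly C},
    forall t : int, f t = (g (t %% p%:Z)%Z).[t%:~R].

Definition quasi_polynomial f : Prop := exists p, has_period f p.

Definition minimal_period f : nat :=
  xget 0%N [set p | has_period f p /\
                    forall p', has_period f p' -> (p <= p')%N].

(* [xget] picks the element of a set that is in fact a singleton: there is at
   most one such quasi-polynomial. *)
Definition eventual_quasi_polynomial (u : nat -> nat) : int -> C :=
  xget (fun=> 0) [set f | quasi_polynomial f /\
    exists q0 : nat, forall q : nat, (q0 < q)%N -> f q%:Z = (u q)%:R].

(* Same, but agreement is required for every q >= 0. *)
Definition quasi_polynomial_of (u : nat -> nat) : int -> C :=
  xget (fun=> 0) [set f | quasi_polynomial f /\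
    forall q : nat, f q%:Z = (u q)%:R].

Definition shift f : int -> C := fun t => f (t - 1).

Definition shift_poly (P : {poly C}) f : int -> C :=
  fun t => \sum_(i < size P) P`_i * iter i shift f t.

Definition bracket (A : nzRingType) (m : nat) (x : A) : A :=
  \sum_(i < m) x ^+ i.

End QuasiPolynomials.

Section Alcove.
Variables (R : realType) (l : nat).
Local Notation V := 'rV[R]_l.
Implicit Types (alpha : 'I_l -> V) (c : 'I_l -> nat).

Definition alcove_points alpha c (q : nat) : set V :=
  [set x | [/\ coweight_lattice alpha x,
               forall i, 0 <= dot (alpha i) x
             & dot (nat_comb alpha c) x <= q%:R]].

Definition ehrhart alpha c : int -> R[i] :=
  quasi_polynomial_of R (fun q => ncard (alcove_points alpha c q)).

End Alcove.

Section Arrangements.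
Variables (R : realType) (l : nat).
Local Notation V := 'rV[R]_l.
Local Notation C := R[i].
Implicit Types (Phi : {fset V}) (alpha : 'I_l -> V).

Definition hyperplane (a : V) (k : nat) : set V := [set x | dot a x = k%:R].

Definition linial Phi alpha (n : nat) : {fset set V} :=
  [fset hyperplane a k | a in pos_roots Phi alpha, k in iota 1 n].

(* The largest d such that S contains d + 1 affinely independent points. *)
Definition affine_dim (S : set V) : nat :=
  \max_(d < l.+1 | `[< exists (x : V) (v : d.-tuple V),
                         [/\ S x, free v & forall i, S (x + tnth v i)] >]) d.

Definition inter_of (B : {fset set V}) : set V := \bigcap_(H in [set` B]) H.

Definition char_poly_arr (A : {fset set V}) : {poly C} :=
  \sum_(B <- fpowerset A | `[< inter_of B !=set0 >])
     (-1) ^+ #|` B | *: 'X^(affine_dim (inter_of B)).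

Definition coset_mod alpha (q : nat) (x : V) : set V :=
  [set x + q%:R *: z | z in coweight_lattice alpha].

(* The cosets in Z(Phi)/qZ(Phi) lying in the complement of the arrangement
   modulo q; the condition does not depend on the representative x. *)
Definition linial_complement Phi alpha (n q : nat) : set (set V) :=
  [set coset_mod alpha q x | x in
     [set x | coweight_lattice alpha x /\
        forall a k, a \in pos_roots Phi alpha -> (1 <= k <= n)%N ->
          ~ exists m : int, dot a x - k%:R = m%:~R * q%:R]].

Definition char_quasi Phi alpha (n : nat) : int -> C :=
  eventual_quasi_polynomial R
    (fun q => ncard (linial_complement Phi alpha n q)).

End Arrangements.

(* Main.v *)
Require Import Defs.
From HB Require Import structures.
From mathcomp Require Import all_boot all_order all_algebra finmap.
From mathcomp Require Import boolp classical_sets functions cardinality reals.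
From mathcomp Require Import complex.
From mathcomp Require Import mxabelem.
From mathcomp Require Import ring lra zify.

Set Implicit Arguments.
Unset Strict Implicit.
Unset Printing Implicit Defensive.

Import Order.TTheory GRing.Theory Num.Theory.

Local Open Scope ring_scope.

(* Write m = n + 1 and let L be the Ehrhart quasi-polynomial of the alcove, whose
   values are the coefficients of prod_j 1/(1 - x^(c_j)).

   Perturbing a coweight x slightly puts it in a unique open alcove of the affine
   arrangement dilated by q. The condition that x avoids the hyperplanes modulo q
   only concerns the walls of that alcove: x must stay at distance at least m from
   the walls whose inward normal is a positive root. Counting alcove by alcove,
   through bases b of the root system that label the walls, gives
     f #(points) = sum_b L(q - m a_b),
   where f is the number of labellings of one alcove and a_b depends only on b.
   For n = 0 this is Worpitzky's identity f q^l = sum_b L(q - a_b).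

   Since L(q) is the sum over r in [0,m)^(l+1) of L((q - c.r)/m), restricted to
   those r with m | q - c.r, the number of points is the sum over the same r of
   ((q - c.r)/m)^l. The claimed value is m^-(l+1) sum_r (q - c.r)^l over all r; the
   difference has both periods m and rho, hence is a polynomial, and its
   constituents modulo m add up to zero.

   For the roots, prod_j [m]_(x^(c_j)) is a product of factors x - t with |t| = 1
   and t <> 1, and each operator S - t moves the line that carries the roots by 1/2.
   The polynomial is the characteristic polynomial of the arrangement because both
   agree at large primes, by inclusion-exclusion over the field F_p. *)

(** * Reflections and labelled bases *)

Section Reflections.
Variables (R : realType) (l : nat).
Local Notation V := 'rV[R]_l.
Implicit Types (a x y : V) (b : 'I_l -> V).

Lemma dotC x y : dot x y = dot y x.
Proof. by apply: eq_bigr => i _; rewrite mulrC. Qed.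

Lemma dotDr x y z : dot x (y + z) = dot x y + dot x z.
Proof.
by rewrite /dot -big_split; apply: eq_bigr => i _; rewrite mxE mulrDr.
Qed.

Lemma dotZr k x y : dot x (k *: y) = k * dot x y.
Proof.
by rewrite /dot mulr_sumr; apply: eq_bigr => i _; rewrite mxE mulrCA.
Qed.

Lemma dotNr x y : dot x (- y) = - dot x y.
Proof. by rewrite -scaleN1r dotZr mulN1r. Qed.

Lemma dotBr x y z : dot x (y - z) = dot x y - dot x z.
Proof. by rewrite dotDr dotNr. Qed.

Lemma dot0r x : dot x 0 = 0.
Proof. by rewrite -[0](scale0r 0) dotZr mul0r. Qed.

Lemma dotDl x y z : dot (y + z) x = dot y x + dot z x.
Proof. by rewrite dotC dotDr !(dotC x). Qed.

Lemma dotZl k x y : dot (k *: y) x = k * dot y x.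
Proof. by rewrite dotC dotZr dotC. Qed.

Lemma dotNl x y : dot (- y) x = - dot y x.
Proof. by rewrite dotC dotNr dotC. Qed.

Lemma dotBl x y z : dot (y - z) x = dot y x - dot z x.
Proof. by rewrite dotDl dotNl. Qed.

Lemma dot_suml I (r : seq I) (F : I -> V) x :
  dot (\sum_(i <- r) F i) x = \sum_(i <- r) dot (F i) x.
Proof.
elim: r => [|i r IH]; first by rewrite !big_nil dotC dot0r.
by rewrite !big_cons dotDl IH.
Qed.

Lemma dot_gt0 x : x != 0 -> 0 < dot x x.
Proof.
move=> x0; rewrite lt_neqAle eq_sym; apply/andP; split; last first.
  by apply: sumr_ge0 => i _; rewrite -expr2 sqr_ge0.
apply: contra x0 => /eqP /psumr_eq0P xx0; apply/eqP/rowP => i.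
have /eqP : x 0 i * x 0 i = 0 by apply: xx0 => // j _; rewrite -expr2 sqr_ge0.
by rewrite -expr2 sqrf_eq0 mxE => /eqP.
Qed.

Lemma dot_nat_comb b m x :
  dot (nat_comb b m) x = \sum_i (m i)%:R * dot (b i) x.
Proof. by rewrite dot_suml; apply: eq_bigr => i _; rewrite dotZl. Qed.

Definition coroot a : V := (2%:R / dot a a) *: a.

Lemma reflE a x : refl a x = x - dot a x *: coroot a.
Proof. by rewrite /refl /coroot scalerA mulrCA mulrA. Qed.

Lemma dot_coroot a x : dot x (coroot a) = 2%:R * dot a x / dot a a.
Proof. by rewrite dotZr (dotC x) mulrAC. Qed.

Lemma dot_coroot_id a : a != 0 -> dot a (coroot a) = 2.
Proof. by move=> /dot_gt0 /lt0r_neq0 a0; rewrite dot_coroot mulfK. Qed.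

Lemma dot_refll a x y : dot (refl a x) y = dot x y - dot x (coroot a) * dot a y.
Proof. by rewrite dotBl dotZl dot_coroot. Qed.

Lemma dot_reflr a x y : dot x (refl a y) = dot (refl a x) y.
Proof. by rewrite dot_refll reflE dotBr dotZr mulrC. Qed.

Lemma reflK a : a != 0 -> involutive (refl a).
Proof.
move=> a0 x; rewrite [refl a (refl a x)]reflE dot_reflr dot_refll.
rewrite dot_coroot_id // reflE mulr_natl mulr2n opprD addrA subrr sub0r.
by rewrite scaleNr opprK subrK.
Qed.

Lemma refl_id a : a != 0 -> refl a a = - a.
Proof.
move=> /dot_gt0 /lt0r_neq0 a0.
by rewrite /refl mulfK // scaler_nat mulr2n opprD addNKr.
Qed.

Lemma reflB a x y : refl a (x - y) = refl a x - refl a y.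
Proof.
rewrite !reflE dotBr scalerBl; apply/rowP => i; rewrite !mxE.
by ring.
Qed.

Lemma reflN a x : refl a (- x) = - refl a x.
Proof. by rewrite !reflE dotNr scaleNr opprB opprK addrC. Qed.

Lemma refl_nat_comb a b m :
  nat_comb (fun i => refl a (b i)) m = refl a (nat_comb b m).
Proof.
rewrite [in RHS]/nat_comb reflE.
rewrite dotC dot_suml scaler_suml -sumrB; apply: eq_bigr => i _.
by rewrite reflE scalerBr dotZl (dotC (b i)) scalerA.
Qed.

End Reflections.

Section Bases.
Variables (R : realType) (l : nat) (Phi : {fset 'rV[R]_l}) (c : 'I_l -> nat).
Local Notation V := 'rV[R]_l.
Implicit Types (a x y : V) (b : 'I_l -> V).

(* These bases stand for the automorphisms of the root system: one sums over them
   instead of over group elements. The second clause provides the dual basis. *)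
Definition labelled_base b :=
  [/\ forall i, b i \in Phi,
      forall y : 'I_l -> R, exists x, forall i, dot (b i) x = y i,
      forall r, r \in Phi -> exists m : 'I_l -> nat,
        (forall i, m i <= c i)%N /\
        (r = nat_comb b m \/ r = - nat_comb b m)
    & nat_comb b c \in Phi].

Hypothesis rsPhi : root_system Phi.

Lemma root_neq0 a : a \in Phi -> a != 0.
Proof. by move=> aP; case: rsPhi => n0 _ _ _ _; apply: contraNneq n0 => <-. Qed.

Lemma root_refl a r : a \in Phi -> r \in Phi -> refl a r \in Phi.
Proof. by case: rsPhi => _ _ H _ _; apply: H. Qed.

Lemma root_opp a : a \in Phi -> - a \in Phi.
Proof. by move=> aP; rewrite -refl_id ?root_neq0 // root_refl. Qed.

Lemma dot_coroot_int a r : a \in Phi -> r \in Phi ->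
  dot r (coroot a) \is a Num.int.
Proof. by case: rsPhi => _ _ _ H _ aP rP; rewrite dot_coroot; apply: H. Qed.

Lemma labelled_base_refl a b : a \in Phi -> labelled_base b ->
  labelled_base (fun i => refl a (b i)).
Proof.
move=> aP [bP bD bC bH]; have a0 := root_neq0 aP; split.
- by move=> i; apply: root_refl.
- move=> y; have [x xy] := bD y; exists (refl a x) => i.
  by rewrite -xy dot_reflr reflK.
- move=> r rP; have [m [mc rm]] := bC _ (root_refl aP rP); exists m; split => //.
  rewrite refl_nat_comb -[r](reflK a0).
  by case: rm => ->; [left|right; rewrite reflN].
- by rewrite refl_nat_comb root_refl.
Qed.

(** Freeness of l vectors in dimension l makes the matrix with these rows invertible, and its
    inverse solves for x. *)
Lemma free_dual b : free [tuple b i | i < l] ->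
  forall y : 'I_l -> R, exists x, forall i, dot (b i) x = y i.
Proof.
move=> bf y; set B := \matrix_i b i.
have B_unit : B \in unitmx.
  rewrite -row_free_unit -kermx_eq0; apply/rowV0P => v /sub_kermxP vB.
  apply/rowP => i; rewrite mxE.
  move/freeP: bf => /(_ (fun i => v 0 i)); apply.
  rewrite -[RHS]vB mulmx_sum_row; apply: eq_bigr => j _.
  by rewrite -tnth_nth tnth_mktuple rowK.
exists (invmx B *m (\col_i y i))^T => i.
have <- : (B *m (invmx B *m (\col_i y i))) i 0 = y i.
  by rewrite mulmxA mulmxV // mul1mx mxE.
by rewrite [RHS]mxE; apply: eq_bigr => j _; rewrite !mxE.
Qed.

End Bases.

(** * Alcoves *)

Section Alcoves.
Variables (R : realType) (l : nat) (Phi : {fset 'rV[R]_l}) (c : 'I_l -> nat).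
Local Notation V := 'rV[R]_l.
Implicit Types (a x y z p r : V) (b : 'I_l -> V).
Hypothesis rsPhi : root_system Phi.

Local Notation labelled_base := (labelled_base Phi c).

(** Pairing with a dual basis vector reads off one coefficient, so the nonnegative combination
    [nat_comb b c - r] bounds each coefficient of r by the corresponding mark. For a negative root
    the bound comes from its opposite. *)
Lemma simple_labelled_base b :
  simple_system Phi b -> highest_root Phi b (nat_comb b c) -> labelled_base b.
Proof.
move=> [bP bF bC] [hP hC]; split => //; first exact: free_dual.
have bound m m' : nat_comb b c - nat_comb b m = nat_comb b m' ->
    forall i, (m i <= c i)%N.
  move=> e i; have [x xb] := free_dual bF (fun j => (j == i)%:R).
  have H k : dot (nat_comb b k) x = (k i)%:R.
    rewrite dot_nat_comb (bigD1 i) //= xb eqxx mulr1 big1 ?addr0 // => j /negPf ji.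
    by rewrite xb ji mulr0.
  have := congr1 (fun v => dot v x) e; rewrite /= dotBl !H => e'.
  by rewrite -(ler_nat R) -subr_ge0 e' ler0n.
move=> r rP; have [m [rm|rm]] := bC _ rP; exists m; split; try by [left|right].
  by have [m'] := hC _ rP; rewrite rm => /bound.
by have [m'] := hC _ (root_opp rsPhi rP); rewrite rm opprK => /bound.
Qed.

Lemma labelled_base_root b r : labelled_base b -> r \in Phi ->
  exists m : 'I_l -> nat, [/\ (forall i, m i <= c i)%N, (exists i, 0 < m i)%N
    & (forall x, dot r x = \sum_i (m i)%:R * dot (b i) x) \/
      (forall x, dot r x = - \sum_i (m i)%:R * dot (b i) x)].
Proof.
move=> [_ _ bC _] rP; have [m [mc rm]] := bC _ rP; exists m; split => //.
  apply/existsP; rewrite -[X in is_true X]negbK negb_exists.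
  apply/negP => /forallP m0; have := root_neq0 rsPhi rP.
  have -> : r = 0; last by rewrite eqxx.
  have H : nat_comb b m = 0.
    rewrite /nat_comb big1 // => i _; have := m0 i.
    by rewrite -eqn0Ngt => /eqP ->; rewrite scale0r.
  by case: rm; rewrite H ?oppr0.
by case: rm => ->; [left|right] => x; rewrite ?dotNl dot_nat_comb.
Qed.

(** The root [b i] has coefficients bounded by the marks, and its i-th coefficient cannot vanish
    because a dual basis vector pairs to 1 with it. *)
Lemma marks_gt0 b i : labelled_base b -> (0 < c i)%N.
Proof.
move=> bb; have [bP bD _ _] := bb; have [x xb] := bD (fun j => (j == i)%:R).
have [m [mc _ mb]] := labelled_base_root bb (bP i).
have H k : \sum_(j < l) (k j)%:R * dot (b j) x = (k i)%:R.
  rewrite (bigD1 i) //= xb eqxx mulr1 big1 ?addr0 // => j /negPf ji.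
  by rewrite xb ji mulr0.
apply: (leq_trans _ (mc i)); rewrite lt0n; apply/negP => /eqP mi.
have : dot (b i) x = 1 by rewrite xb eqxx.
by case: mb => ->; rewrite H mi; lra.
Qed.

(** A description of Z(Phi) without reference to a base, so that its stability under reflections is
    immediate. *)
Definition coweight x := forall r, r \in Phi -> dot r x \is a Num.int.

Lemma coweightP b x : labelled_base b -> coweight_lattice b x <-> coweight x.
Proof.
move=> bb; have [bP _ _ _] := bb; split => [xb r rP|xP i]; last exact: xP.
have [m [_ _ H]] := labelled_base_root bb rP.
have S : \sum_i (m i)%:R * dot (b i) x \is a Num.int.
  by apply: rpred_sum => i _; rewrite rpredM // rpred_nat.
by case: H => ->; rewrite ?rpredN.
Qed.

Lemma coweightD x y : coweight x -> coweight y -> coweight (x + y).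
Proof. by move=> xP yP r rP; rewrite dotDr rpredD ?xP ?yP. Qed.

Lemma coweightN x : coweight x -> coweight (- x).
Proof. by move=> xP r rP; rewrite dotNr rpredN xP. Qed.

Lemma coweightB x y : coweight x -> coweight y -> coweight (x - y).
Proof. by move=> xP yP; apply/coweightD/coweightN. Qed.

Lemma coweightZ (k : R) x : k \is a Num.int -> coweight x -> coweight (k *: x).
Proof. by move=> kP xP r rP; rewrite dotZr rpredM ?xP. Qed.

Lemma coweight_coroot a : a \in Phi -> coweight (coroot a).
Proof. by move=> aP r rP; apply: (dot_coroot_int rsPhi). Qed.

Lemma coweight_refl a x : a \in Phi -> coweight x -> coweight (refl a x).
Proof. by move=> aP xP r rP; rewrite dot_reflr xP ?root_refl. Qed.

(** Such points are those in the open alcoves of the affine arrangement. *)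
Definition generic p := forall r, r \in Phi -> dot r p \isn't a Num.int.

Lemma generic_refl a p : a \in Phi -> generic p -> generic (refl a p).
Proof. by move=> aP gp r rP; rewrite dot_reflr gp ?root_refl. Qed.

Lemma genericD x p : coweight x -> generic p -> generic (p + x).
Proof.
move=> xP gp r rP; apply: contra (gp r rP) => H.
by rewrite -[dot r p](addrK (dot r x)) -dotDr rpredB ?xP.
Qed.

Definition in_alcove b p :=
  (forall i, 0 < dot (b i) p) /\ dot (nat_comb b c) p < 1.

(** For generic p these bases are the labellings of the walls of the alcove around p, each alcove
    being brought to the fundamental one of b by a coweight translation. Functions into the finite
    type [Phi] make the set finite. *)
Definition alcove_bases p : {set {ffun 'I_l -> Phi}} :=
  [set b : {ffun 'I_l -> Phi} | `[< labelled_base (fun i => fsval (b i)) /\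
    exists2 x, coweight x & in_alcove (fun i => fsval (b i)) (p - x) >]].

Lemma alcove_basesP p (b : {ffun 'I_l -> Phi}) :
  reflect (labelled_base (fun i => fsval (b i)) /\
    exists2 x, coweight x & in_alcove (fun i => fsval (b i)) (p - x))
  (b \in alcove_bases p).
Proof. by rewrite finset.in_set; apply: asboolP. Qed.

Lemma alcove_bases_translate x p : coweight x ->
  alcove_bases (p + x) = alcove_bases p.
Proof.
move=> xP; apply/setP => b; apply/alcove_basesP/alcove_basesP.
  move=> [bb [y yP bp]]; split => //; exists (y - x); first exact: coweightB.
  by rewrite opprB addrA.
move=> [bb [y yP bp]]; split => //; exists (y + x); first exact: coweightD.
by rewrite opprD addrACA subrr addr0.
Qed.

Lemma in_alcove_refl a b p :
  in_alcove (fun i => refl a (b i)) p <-> in_alcove b (refl a p).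
Proof.
rewrite /in_alcove refl_nat_comb -dot_reflr.
by split=> -[H1 H2]; split=> // i; [rewrite dot_reflr|rewrite -dot_reflr].
Qed.

Definition refl_base a (aP : a \in Phi) (b : {ffun 'I_l -> Phi}) :
    {ffun 'I_l -> Phi} :=
  [ffun i => [` root_refl rsPhi aP (fsvalP (b i))]%fset].

Lemma refl_baseK a (aP : a \in Phi) : involutive (refl_base aP).
Proof.
move=> b; apply/ffunP => i; apply: val_inj; rewrite !ffunE /=.
by rewrite reflK // (root_neq0 rsPhi).
Qed.

Lemma alcove_bases_refl_sub a (aP : a \in Phi) p (b : {ffun 'I_l -> Phi}) :
  b \in alcove_bases p -> refl_base aP b \in alcove_bases (refl a p).
Proof.
move=> /alcove_basesP [bb [x xP bp]]; apply/alcove_basesP.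
have -> : (fun i => fsval (refl_base aP b i)) = (fun i => refl a (fsval (b i))).
  by apply: funext => i; rewrite ffunE.
split; first exact: labelled_base_refl.
exists (refl a x); first exact: coweight_refl.
by apply/in_alcove_refl; rewrite -reflB reflK // (root_neq0 rsPhi).
Qed.

Lemma card_alcove_bases_refl a p : a \in Phi ->
  #|alcove_bases (refl a p)| = #|alcove_bases p|.
Proof.
move=> aP; have rK := refl_baseK aP.
rewrite -[RHS](card_imset _ (can_inj rK)); apply: eq_card => b.
apply/idP/imsetP => [bp|[b' bp ->]]; last exact: alcove_bases_refl_sub.
exists (refl_base aP b); last by rewrite rK.
have := alcove_bases_refl_sub aP bp.
by rewrite reflK // (root_neq0 rsPhi).
Qed.

(** Up to sign r has nonnegative coefficients, not all zero and at most the marks, so its value lies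
    between 0 and that of the highest root. *)
Lemma root_in_alcove b r : labelled_base b -> r \in Phi ->
  (forall p, in_alcove b p -> 0 < dot r p < 1) \/
  (forall p, in_alcove b p -> - 1 < dot r p < 0).
Proof.
move=> bb rP; have [m [mc [i mi] H]] := labelled_base_root bb rP.
have S p : in_alcove b p -> 0 < \sum_i (m i)%:R * dot (b i) p < 1.
  move=> [bp hp]; apply/andP; split.
    rewrite (bigD1 i) //= ltr_pwDl ?mulr_gt0 ?ltr0n ?bp //.
    by apply: sumr_ge0 => j _; rewrite mulr_ge0 ?ler0n // ltW.
  apply: le_lt_trans hp; rewrite dot_nat_comb; apply: ler_sum => j _.
  by rewrite ler_wpM2r ?ler_nat // ltW.
by case: H => H; [left|right] => p /S; rewrite H // => /andP[? ?]; apply/andP; lra.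
Qed.

Lemma in_alcove_bases_sub b p z : labelled_base b ->
  in_alcove b p -> in_alcove b z -> alcove_bases p \subset alcove_bases z.
Proof.
move=> bb bp bz.
(* No integral level of a root separates two points of one alcove, since the root takes values there
   between two consecutive integers. *)
have cell r (t : R) :
    r \in Phi -> t \is a Num.int -> t < dot r p -> t < dot r z.
  move=> rP /intrP [k ->] kp; have [H|H] := root_in_alcove bb rP.
    have /andP [_ p1] := H _ bp; have /andP [z0 _] := H _ bz.
    have : k%:~R < 1%:~R :> R by apply: lt_trans p1.
    rewrite ltr_int => k1; apply: le_lt_trans z0.
    by rewrite -[0]/(0%:~R) ler_int; lia.
  have /andP [_ p1] := H _ bp; have /andP [z0 _] := H _ bz.
  have : k%:~R < 0%:~R :> R by apply: lt_trans p1.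
  rewrite ltr_int => k1; apply: le_lt_trans z0.
  by rewrite -[-1]/((-1)%:~R) ler_int; lia.
apply/fintype.subsetP => b' /alcove_basesP [bb' [x xP [H1 H2]]].
apply/alcove_basesP; split => //; exists x => //; split.
  move=> i; rewrite dotBr subr_gt0; apply: cell; rewrite ?fsvalP ?xP ?fsvalP //.
  by rewrite -subr_gt0 -dotBr.
(* The upper bound at the top wall is a lower bound for the opposite of the highest root, to which
   [cell] applies. *)
have hP : - nat_comb (fun i => fsval (b' i)) c \in Phi.
  by apply: root_opp => //; case: bb'.
have E t : (dot (nat_comb (fun i => fsval (b' i)) c) (t - x) < 1) =
   (dot (- nat_comb (fun i => fsval (b' i)) c) x - 1 <
    dot (- nat_comb (fun i => fsval (b' i)) c) t).
  by rewrite dotBr !dotNl; apply/idP/idP; lra.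
rewrite E; apply: cell => //; last by rewrite -E.
by rewrite rpredB ?xP ?rpred1.
Qed.

Lemma in_alcove_bases b p z : labelled_base b ->
  in_alcove b p -> in_alcove b z -> alcove_bases p = alcove_bases z.
Proof.
by move=> bb bp bz; apply/eqP; rewrite finset.eqEsubset !(in_alcove_bases_sub bb).
Qed.

End Alcoves.

(** * All alcoves have the same number of labellings *)

Section Descent.
Variables (R : realType) (l : nat) (Phi : {fset 'rV[R]_l}) (c : 'I_l -> nat).
Local Notation V := 'rV[R]_l.
Implicit Types (a x y z p v r : V).
Hypothesis rsPhi : root_system Phi.

Lemma sum_root_refl a (F : V -> R) : a \in Phi ->
  \sum_(r <- Phi) F (refl a r) = \sum_(r <- Phi) F r.
Proof.
move=> aP; have rK := reflK (root_neq0 rsPhi aP).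
rewrite -(big_map (refl a) xpredT F); apply: perm_big; apply: uniq_perm.
- by rewrite map_inj_uniq ?fset_uniq //; apply: can_inj rK.
- exact: fset_uniq.
move=> r; apply/mapP/idP => [[s sP ->]|rP]; first exact: root_refl.
by exists (refl a r); rewrite ?rK // root_refl.
Qed.

(** A quadratic form invariant under reflections that, unlike [dot], is guaranteed to take integral
    values on coweights; this makes the descent below terminate. *)
Definition root_form v : R := \sum_(r <- Phi) dot r v ^+ 2.

Lemma root_form_ge0 v : 0 <= root_form v.
Proof. by apply: sumr_ge0 => r _; apply: sqr_ge0. Qed.

Lemma root_formZ k v : root_form (k *: v) = k ^+ 2 * root_form v.
Proof. by rewrite mulr_sumr; apply: eq_bigr => r _; rewrite dotZr exprMn. Qed.

Lemma root_form_int v : coweight Phi v -> root_form v \is a Num.int.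
Proof.
move=> vP; rewrite /root_form big_seq; apply: rpred_sum => r rP.
by rewrite rpredX ?vP.
Qed.

Lemma root_form_coroot_gt0 a : a \in Phi -> 0 < root_form (coroot a).
Proof.
move=> aP; rewrite /root_form (big_fsetD1 a) //=.
rewrite (dot_coroot_id (root_neq0 rsPhi aP)) ltr_pwDl ?exprn_gt0 //.
by apply: sumr_ge0 => r _; apply: sqr_ge0.
Qed.

(* Summing over the reflected roots shows that coroot a is orthogonal to the
   mirror of a for the polar form of [root_form]. *)
Lemma root_form_polar a v : a \in Phi ->
  2 * \sum_(r <- Phi) dot r v * dot r (coroot a) =
  dot a v * root_form (coroot a).
Proof.
move=> aP; have ac := dot_coroot_id (root_neq0 rsPhi aP).
have := sum_root_refl (fun r => dot r v * dot r (coroot a)) aP.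
rewrite (eq_bigr (fun r => - (dot r v * dot r (coroot a))
    + dot a v * dot r (coroot a) ^+ 2)) => [|r _]; last first.
  by rewrite !dot_refll ac; ring.
rewrite big_split /= sumrN -mulr_sumr -/(root_form _) => H.
by rewrite mulr_natl mulr2n -[X in X + _ = _]H addrAC addNr add0r.
Qed.

(** Expanding the squares leaves the polar term given by [root_form_polar]. The form decreases
    exactly when d lies strictly between 0 and [dot a v]. *)
Lemma root_formB_coroot a v d : a \in Phi ->
  root_form (v - d *: coroot a) =
  root_form v - d * (dot a v - d) * root_form (coroot a).
Proof.
move=> aP; have H := root_form_polar v aP.
transitivity (root_form v - d * (2 * \sum_(r <- Phi) dot r v * dot r (coroot a))
   + d ^+ 2 * root_form (coroot a)); last by rewrite H; ring.
rewrite /root_form !mulr_sumr -sumrB -big_split /=; apply: eq_bigr => r _.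
by rewrite dotBr dotZr; ring.
Qed.

(* Descent: if a wall of the alcove of z separates p from z, reflecting p in that
   wall decreases [root_form (p - z)], which takes discrete values. *)
Lemma card_alcove_bases_const (b : 'I_l -> V) M z p :
  labelled_base Phi c b -> in_alcove c b z -> (0 < M)%N ->
  coweight Phi (M%:R *: z) -> coweight Phi (M%:R *: p) -> generic Phi p ->
  #|alcove_bases Phi c p| = #|alcove_bases Phi c z|.
Proof.
move=> bb bz M0 zM; have [bP _ _ hP] := bb.
(* The factor M turns x - z into a coweight, so E takes natural numbers as values and the induction
   runs on a strict upper bound N. *)
pose E x := root_form (M%:R *: (x - z)).
have Eint x : coweight Phi (M%:R *: x) -> E x \is a Num.int.
  by move=> xM; apply: root_form_int; rewrite scalerBr; apply: coweightB.
suff main N x : E x < N%:R -> coweight Phi (M%:R *: x) -> generic Phi x ->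
    #|alcove_bases Phi c x| = #|alcove_bases Phi c z|.
  move=> pM; have /intrP [k Ek] := Eint p pM.
  have k0 : 0 <= k by have := root_form_ge0 (M%:R *: (p - z)); rewrite -/(E p) Ek ler0z.
  apply: (main `|k|.+1) => //; rewrite Ek pmulrn ltr_int; lia.
elim: N x => [|N IH] x ExN xM gx.
  by have := root_form_ge0 (M%:R *: (x - z)); rewrite leNgt ExN.
(* The sign condition says that the hyperplane where a takes the value k strictly separates x from
   z; x' is the mirror image of x in it. *)
have step a (k : int) : a \in Phi -> 0 < (dot a x - k%:~R) * (k%:~R - dot a z) ->
    #|alcove_bases Phi c x| = #|alcove_bases Phi c z|.
  move=> aP dk; pose x' := refl a x + k%:~R *: coroot a.
  have kc : coweight Phi (k%:~R *: coroot a).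
    by apply: coweightZ => //; apply: coweight_coroot.
  have x'M : coweight Phi (M%:R *: x').
    rewrite scalerDr; apply: coweightD.
      have -> : M%:R *: refl a x = refl a (M%:R *: x).
        by rewrite !reflE scalerBr dotZr scalerA.
      exact: coweight_refl.
    by apply: coweightZ => //; apply: natr_int.
  have gx' : generic Phi x' by apply: genericD => //; apply: generic_refl.
  rewrite -(card_alcove_bases_refl c rsPhi x aP) -(alcove_bases_translate _ _ kc).
  apply: IH => //.
  suff : E x' < E x.
    have /intrP [i ->] := Eint _ x'M; move: ExN; have /intrP [j ->] := Eint _ xM.
    by rewrite !pmulrn !ltr_int; lia.
  rewrite /E !root_formZ ltr_pM2l ?exprn_gt0 ?ltr0n //.
  have -> : x' - z = (x - z) - (dot a x - k%:~R) *: coroot a.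
    by rewrite /x' reflE; apply/rowP => i; rewrite !mxE; ring.
  rewrite root_formB_coroot // ltrBlDr ltrDl mulr_gt0 ?root_form_coroot_gt0 //.
  by rewrite dotBr (_ : _ - _ - _ = k%:~R - dot a z) //; ring.
have [bz1 bz2] := bz.
have lt0_generic r (k : int) : r \in Phi -> dot r x <= k%:~R -> dot r x < k%:~R.
  move=> rP; rewrite le_eqVlt => /orP [/eqP rx|//].
  by have := gx r rP; rewrite rx intr_int.
(* Either a wall [b i], or the top wall at level 1, separates x from z, or x lies in the alcove of
   z. *)
have [[i bx]|bx] := pselect (exists i, dot (b i) x <= 0).
  apply: (step (b i) 0) => //; rewrite nmulr_rgt0 ?sub0r ?oppr_lt0 ?bz1 //.
  by rewrite subr0; apply: (lt0_generic _ 0).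
have [hx|hx] := leP 1 (dot (nat_comb b c) x).
  apply: (step _ 1 hP); rewrite mulr_gt0 ?subr_gt0 //.
  rewrite lt_neqAle hx andbT; apply: contraNneq (gx _ hP) => <-.
  by rewrite intr_int.
congr #|pred_of_set _|; apply: (in_alcove_bases rsPhi bb _ bz); split => // i.
by rewrite ltNge; apply/negP => H; apply: bx; exists i.
Qed.
End Descent.

Section DualBasis.
Variables (R : realType) (l : nat) (Phi : {fset 'rV[R]_l}) (c : 'I_l -> nat).
Local Notation V := 'rV[R]_l.
Variable b : 'I_l -> V.
Hypothesis bb : labelled_base Phi c b.

Definition dual_comb (y : 'I_l -> R) : V :=
  xget 0 [set x | forall i, dot (b i) x = y i]%classic.

Lemma dual_combE y i : dot (b i) (dual_comb y) = y i.
Proof.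
have [_ bD _ _] := bb.
exact: (@xgetPex _ 0 [set x | forall i, dot (b i) x = y i]%classic (bD y) i).
Qed.

Lemma base_unitmx : \matrix_i b i \in unitmx.
Proof.
pose W := \matrix_j dual_comb (fun i => (i == j)%:R).
have BW : (\matrix_i b i) *m W^T = 1%:M.
  apply/matrixP => i j; rewrite !mxE.
  rewrite -(dual_combE (fun i => (i == j)%:R) i).
  by apply: eq_bigr => k _; rewrite !mxE.
by have [] := mulmx1_unit BW.
Qed.

Lemma dot_base_inj x x' : (forall i, dot (b i) x = dot (b i) x') -> x = x'.
Proof.
have BE u : (\matrix_i b i) *m u^T = \col_i dot (b i) u.
  by apply/colP => i; rewrite !mxE; apply: eq_bigr => k _; rewrite !mxE.
move=> xx'; apply/trmx_inj/(can_inj (mulKmx base_unitmx)).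
by rewrite !BE; apply/colP => i; rewrite !mxE.
Qed.

End DualBasis.

(** * Lattice points avoiding the arrangement *)

Section MainCount.
Variables (R : realType) (l : nat) (Phi : {fset 'rV[R]_l}) (c : 'I_l -> nat).
Local Notation V := 'rV[R]_l.
Implicit Types (a x p r : V).
Hypothesis rsPhi : root_system Phi.
Variable alpha : 'I_l -> V.
Hypothesis ab : labelled_base Phi c alpha.

(** Classically the half sum of the positive coroots; pairing a root with it gives the height of the
    root. *)
Definition weyl_covector : V := dual_comb alpha (fun=> 1).
Local Notation rv := weyl_covector.
Local Notation h := (\sum_i c i).+1.

Lemma dot_weyl_covector i : dot (alpha i) rv = 1.
Proof. by rewrite (dual_combE ab). Qed.

Lemma height_root r : r \in Phi ->
  exists2 k : int, dot r rv = k%:~R & (0 < `|k| < h)%N.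
Proof.
move=> rP; have [m [mc [i mi] H]] := labelled_base_root rsPhi ab rP.
have S : \sum_i (m i)%:R * dot (alpha i) rv = (\sum_i m i)%:~R :> R.
  rewrite -pmulrn natr_sum; apply: eq_bigr => j _.
  by rewrite dot_weyl_covector mulr1.
have S1 : (0 < \sum_i m i < h)%N.
  rewrite ltnS; apply/andP; split; last exact: leq_sum.
  by rewrite (bigD1 i) //= addn_gt0 mi.
case: H => ->; rewrite S; first by exists (\sum_i m i)%N.
by exists (- (\sum_i m i)%N%:Z); rewrite ?intrN ?abszN.
Qed.

Lemma pos_rootsE r : (r \in pos_roots Phi alpha) = (r \in Phi) && (0 < dot r rv).
Proof.
rewrite !inE /=; case rP: (r \in Phi) => //=.
have S (m : 'I_l -> nat) : dot (nat_comb alpha m) rv = (\sum_i m i)%:R.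
  rewrite dot_nat_comb natr_sum; apply: eq_bigr => j _.
  by rewrite dot_weyl_covector mulr1.
apply/asboolP/idP => [[m rm]|r0].
  have [k kr] := height_root rP; rewrite kr -[0]/(0%:~R) ltr_int.
  have : (0 : R) <= dot r rv by rewrite rm S ler0n.
  by rewrite kr ler0z; lia.
have [_ _ bC _] := ab; have [m [_ [rm|rm]]] := bC _ rP; first by exists m.
by move: r0; rewrite rm dotNl S oppr_gt0 ltrn0.
Qed.

Definition ascent r : nat := (0 < dot r rv)%R.

Variable q : nat.
Hypothesis q_gt0 : (0 < q)%N.

(* The shift by - rv / h leaves every hyperplane, because the heights of the roots
   are nonzero and lie strictly between -h and h. *)
Definition perturbed x : V := q%:R^-1 *: (x - h%:R^-1 *: rv).

Let qR : 0 < q%:R :> R. Proof. by rewrite ltr0n. Qed.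
Let hR : 0 < h%:R :> R. Proof. by rewrite ltr0n. Qed.

Lemma dot_perturbed r x : dot r (perturbed x) = (dot r x - dot r rv / h%:R) / q%:R.
Proof. by rewrite dotZr dotBr dotZr mulrC [_^-1 * _]mulrC. Qed.

(** The integer [t + dot r x] is compared with height / h, a nonzero number strictly between -1 and
    1. Exceeding it means being at least 1 if r is positive and at least 0 if r is negative, which
    is the value of [ascent]. *)
Lemma perturbed_gt0 r x (t : int) : r \in Phi -> coweight Phi x ->
  (0 < t%:~R + dot r x - dot r rv / h%:R) = ((ascent r)%:R <= t%:~R + dot r x).
Proof.
move=> rP /(_ r rP) /intrP [X ->]; rewrite /ascent; have [k -> kh] := height_root rP.
rewrite -intrD subr_gt0 ltr_pdivrMr // !pmulrn -intrM ltr_int -[0]/(0%:~R) ltr_int.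
rewrite ler_int; move: kh; move: (t + X) (\sum_i _)%N.+1 => {}X H kh.
case: (ltP 0 k) => k0 /=; apply/idP/idP => HX.
- have [X0|//] := leP X 0; have : X * H%:Z <= 0 by nia.
  by move: (X * _) HX k0 => w; lia.
- have : H%:Z <= X * H%:Z by nia.
  by move: (X * _) kh k0 => w; lia.
- have [//|X0] := leP 0 X; have : X * H%:Z <= - H%:Z by nia.
  by move: (X * _) HX kh k0 => w; lia.
- have : 0 <= X * H%:Z by nia.
  have : k != 0 by lia.
  by move: (X * _) k0 => w; lia.
Qed.

(** An integral value would make the height of r a multiple of h, against [height_root]. *)
Lemma generic_perturbed x : coweight Phi x -> generic Phi (perturbed x).
Proof.
move=> xP r rP; apply/negP => /intrP [j]; rewrite dot_perturbed.
move: (xP _ rP) => /intrP [X ->]; have [k -> kh] := height_root rP.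
move=> e; have : k%:~R = (X%:~R - j%:~R * q%:R) * h%:R :> R.
  by rewrite -e; field; rewrite nat1r !pnatr_eq0 -lt0n q_gt0.
rewrite !pmulrn -intrM -intrB -intrM => /eqP; rewrite eqr_int => /eqP ke.
move: kh; rewrite ke abszM; move: (`|_|%N) => t; case: t => // t.
by rewrite /= mulSn; lia.
Qed.

Lemma coweight_rv : coweight Phi rv.
Proof. by apply/(coweightP rsPhi _ ab) => i; rewrite dot_weyl_covector rpred1. Qed.

Lemma coweight_perturbed x : coweight Phi x ->
  coweight Phi ((h * q)%:R *: perturbed x).
Proof.
move=> xP; rewrite /perturbed natrM -scalerA scalerKV ?lt0r_neq0 //.
rewrite scalerBr scalerKV ?lt0r_neq0 //; apply: coweightB coweight_rv.
by apply: coweightZ => //; apply: natr_int.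
Qed.

Lemma coweight_alcove_center : coweight Phi ((h * q)%:R *: (h%:R^-1 *: rv)).
Proof.
rewrite mulnC natrM -scalerA scalerKV ?lt0r_neq0 //.
by apply: coweightZ coweight_rv; apply: natr_int.
Qed.

Lemma in_alcove_center : in_alcove c alpha (h%:R^-1 *: rv).
Proof.
split=> [i|]; first by rewrite dotZr dot_weyl_covector mulr1 invr_gt0.
have -> : dot (nat_comb alpha c) (h%:R^-1 *: rv) = (\sum_i c i)%:R / h%:R.
  rewrite dotZr dot_nat_comb mulrC natr_sum; congr (_ / _); apply: eq_bigr => i _.
  by rewrite dot_weyl_covector mulr1.
by rewrite ltr_pdivrMr // mul1r ltr_nat.
Qed.

(** This is the constant f. Only its being nonzero matters, because it occurs both in Worpitzky's
    identity and in the count and cancels. *)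
Definition base_number := #|alcove_bases Phi c (h%:R^-1 *: rv)|.

Lemma card_alcove_bases_perturbed x : coweight Phi x ->
  #|alcove_bases Phi c (perturbed x)| = base_number.
Proof.
move=> xP; apply: (card_alcove_bases_const rsPhi ab in_alcove_center (M := h * q)).
- by rewrite muln_gt0 q_gt0.
- exact: coweight_alcove_center.
- exact: coweight_perturbed.
exact: generic_perturbed.
Qed.

Lemma base_number_gt0 : (0 < base_number)%N.
Proof.
have [aP _ _ _] := ab.
apply/card_gt0P; exists [ffun i => [` aP i]%fset]; apply/alcove_basesP.
have -> : (fun i => fsval ([ffun i => [` aP i]%fset] i)) = alpha.
  by apply: funext => i; rewrite ffunE.
split => //; exists 0; last by rewrite subr0; apply: in_alcove_center.
by move=> r _; rewrite dot0r rpred0.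
Qed.

(* A wall of the alcove is kept at distance n + 1 exactly when its inward normal
   is a positive root, and may be reached by x otherwise. *)
Definition wall_gaps (b : 'I_l -> V) n x :=
  (forall i, (n.+1 * ascent (b i))%:R <= dot (b i) x) /\
  dot (nat_comb b c) x + (n.+1 * ascent (- nat_comb b c))%:R <= q%:R.

Lemma in_alcove_perturbed b x : labelled_base Phi c b -> coweight Phi x ->
  in_alcove c b (perturbed x) <-> wall_gaps b 0 x.
Proof.
move=> bb xP; have [bP _ _ hP] := bb; rewrite /in_alcove /wall_gaps.
have H1 i : (0 < dot (b i) (perturbed x)) = ((1 * ascent (b i))%:R <= dot (b i) x).
  rewrite dot_perturbed pmulr_lgt0 ?invr_gt0 // mul1n.
  by have := perturbed_gt0 0 (bP i) xP; rewrite !add0r.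
(* The top wall is treated by [perturbed_gt0] for the opposite of the highest root, with t = q. *)
have H2 : (dot (nat_comb b c) (perturbed x) < 1) =
    (dot (nat_comb b c) x + (1 * ascent (- nat_comb b c))%:R <= q%:R).
  rewrite dot_perturbed ltr_pdivrMr // mul1r mul1n.
  have := perturbed_gt0 q (root_opp rsPhi hP) xP; rewrite -pmulrn !dotNl.
  rewrite (_ : q%:R + _ - _ =
      q%:R - (dot (nat_comb b c) x - dot (nat_comb b c) rv / h%:R)).
    by rewrite subr_gt0 => ->; rewrite lerBrDl.
  by ring.
by rewrite H2; split=> -[A1 A2]; split=> // i; [rewrite -H1|rewrite H1].
Qed.

Definition avoids n x := forall a k, a \in pos_roots Phi alpha ->
  (1 <= k <= n)%N -> ~ exists m : int, dot a x - k%:R = m%:~R * q%:R.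

End MainCount.

(** * Avoidance as gaps at the walls, and congruence modulo q *)

Section Residues.
Variables (R : realType) (l : nat) (Phi : {fset 'rV[R]_l}) (c : 'I_l -> nat).
Local Notation V := 'rV[R]_l.
Implicit Types (a x p r : V).
Hypothesis rsPhi : root_system Phi.
Variable alpha : 'I_l -> V.
Hypothesis ab : labelled_base Phi c alpha.
Variable q : nat.
Hypothesis q_gt0 : (0 < q)%N.

Local Notation rv := (weyl_covector alpha).
Local Notation ascent := (ascent alpha).
Local Notation wall_gaps := (wall_gaps c alpha q).
Local Notation avoids := (avoids Phi alpha q).

Lemma wall_gaps_ge0 b n x i : wall_gaps b n x -> 0 <= dot (b i) x.
Proof. by case=> /(_ i) H _; apply: le_trans H; apply: ler0n. Qed.

(** A nonnegative combination of positive height involves some [b i] of positive height, and that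
    wall alone contributes n + 1. *)
Lemma wall_gaps_sum b n x (w : 'I_l -> nat) : wall_gaps b n x ->
  0 < \sum_i (w i)%:R * dot (b i) rv ->
  n.+1%:R <= \sum_i (w i)%:R * dot (b i) x.
Proof.
move=> gx w0.
have [i /andP [wi bi]] : exists i, (0 < w i)%N && (0 < dot (b i) rv).
  apply/existsP; rewrite -[X in is_true X]negbK negb_exists.
  apply/negP => /forallP H; move: w0; rewrite ltNge => /negP; apply.
  apply: sumr_le0 => i _; have := H i; rewrite negb_and -eqn0Ngt -leNgt.
  case/orP => [/eqP ->|bi]; first by rewrite mul0r.
  by rewrite mulr_ge0_le0 ?ler0n.
rewrite (bigD1 i) //=; apply: ler_wpDr.
  by apply: sumr_ge0 => j _; rewrite mulr_ge0 ?ler0n ?(wall_gaps_ge0 _ gx).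
have [/(_ i) + _] := gx; rewrite /ascent bi muln1 => H.
by apply: le_trans H _; rewrite ler_peMl ?(wall_gaps_ge0 _ gx) // ler1n.
Qed.

(* Among the inequalities imposed by all positive roots, those at the walls of
   the alcove imply the others, since every root is a nonnegative combination
   of the inward normals of the walls. *)
Lemma avoidsP b n x : labelled_base Phi c b -> coweight Phi x ->
  wall_gaps b 0 x -> avoids n x <-> wall_gaps b n x.
Proof.
move=> bb xP g0; have [bP _ _ hP] := bb.
have x_int r : r \in Phi -> exists k : int, dot r x = k%:~R.
  by move=> rP; apply/intrP/xP.
split=> [av|gn].
  (* For a positive root r, a value of t q + [dot r x] between 1 and n would be a level k forbidden
     by [av], with multiple -t of q. *)
  have key r (t : int) : r \in Phi -> (1 * ascent r)%:R <= t%:~R * q%:R + dot r x ->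
      (n.+1 * ascent r)%:R <= t%:~R * q%:R + dot r x.
    move=> rP; rewrite mul1n /ascent; case r0: (0 < dot r rv); last by rewrite muln0.
    rewrite muln1; have [X rX] := x_int _ rP.
    rewrite rX !pmulrn -intrM -intrD !ler_int => X1; rewrite leNgt; apply/negP => Xn.
    apply: (av r `|(t * q%:Z + X)%R|%N _ _ _); first by rewrite (pos_rootsE rsPhi ab) rP.
      by lia.
    exists (- t); rewrite rX !pmulrn -intrM -intrB; congr _%:~R; lia.
  case: g0 => g1 g2; split=> [i|].
    by have := key _ 0 (bP i); rewrite mul0r !add0r; apply.
  have := key _ 1 (root_opp rsPhi hP); rewrite mul1r dotNl.
  by rewrite !lerBrDl; apply.
move=> a k; rewrite (pos_rootsE rsPhi ab) => /andP [aP a0] /andP [k1 kn] [m am].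
have {}am : dot a x = (k%:Z + m * q%:Z)%:~R.
  by rewrite intrD intrM -!pmulrn -am addrC subrK.
(* If a is positive for b, then [dot a x] lies in [n + 1, q], which contains no number congruent
   modulo q to one of 1, ..., n. *)
have [w [wc _ [aw|aw]]] := labelled_base_root rsPhi bb aP.
  have := wall_gaps_sum gn; move=> /(_ w); rewrite -!aw => /(_ a0).
  have : dot a x <= q%:R.
    apply: (@le_trans _ _ (dot (nat_comb b c) x)).
      rewrite dot_nat_comb aw; apply: ler_sum => i _.
      by rewrite ler_wpM2r ?ler_nat ?(wall_gaps_ge0 _ gn).
    by case: gn => _; apply: le_trans; rewrite lerDl.
  rewrite am !pmulrn !ler_int => A1 A2.
  have : 0 < m by nia.
  by nia.
(* Here - a is positive for b, and q + [dot a x] is to lie in [n + 1, q]. Either the top wall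
   supplies the gap, or the highest root plus a, with coefficients c - w, has positive height and
   [wall_gaps_sum] applies. *)
have Ecw y : \sum_i (c i - w i)%N%:R * dot (b i) y = dot (nat_comb b c) y + dot a y.
  rewrite dot_nat_comb aw -sumrB; apply: eq_bigr => i _.
  by rewrite natrB // mulrBl.
have A1 : dot a x <= 0.
  rewrite aw oppr_le0; apply: sumr_ge0 => i _.
  by rewrite mulr_ge0 ?ler0n ?(wall_gaps_ge0 _ gn).
have A2 : n.+1%:R <= q%:R + dot a x.
  have S0 : 0 <= \sum_i (c i - w i)%N%:R * dot (b i) x.
    by apply: sumr_ge0 => i _; rewrite mulr_ge0 ?ler0n ?(wall_gaps_ge0 _ gn).
  case: gn (gn) => _ + gn; rewrite /ascent dotNl oppr_gt0; case: ltP => hr.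
    by rewrite muln1 => ?; move: S0; rewrite Ecw; lra.
  rewrite muln0 => ?; have := wall_gaps_sum gn (w := fun i => (c i - w i)%N).
  rewrite !Ecw => /(_ _); have : 0 < dot (nat_comb b c) rv + dot a rv by lra.
  by move=> H /(_ H); lra.
move: A1 A2; rewrite am !pmulrn -intrD -[0]/(0%:~R) !ler_int => A1 A2.
have : m < 0 by nia.
by nia.
Qed.

Definition congruent x x' := exists2 y, coweight Phi y & x = x' + q%:R *: y.

Lemma congruentP x x' : congruent x x' <->
  forall i, exists m : int, dot (alpha i) x = dot (alpha i) x' + m%:~R * q%:R.
Proof.
have [aP _ _ _] := ab; split=> [[y yP ->] i|xx'].
  have /intrP [m ym] := yP _ (aP i); exists m.
  by rewrite dotDr dotZr ym mulrC.
have [m xm] := choice xx'.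
exists (dual_comb alpha (fun i => (m i)%:~R)).
  apply/(coweightP rsPhi _ ab) => i; rewrite (dual_combE ab); exact: intr_int.
apply: (dot_base_inj ab) => i.
by rewrite xm dotDr dotZr (dual_combE ab) mulrC.
Qed.

Lemma avoids_congruent n x x' : congruent x x' -> avoids n x' -> avoids n x.
Proof.
move=> [y yP ->] av a k aP kn [m am]; apply: (av a k aP kn).
move: aP; rewrite (pos_rootsE rsPhi ab) => /andP [aP _].
have /intrP [j yj] := yP _ aP; exists (m - j).
by rewrite intrB mulrBl -am dotDr dotZr yj; ring.
Qed.

Lemma congruent_sym x x' : congruent x x' -> congruent x' x.
Proof.
move=> [y yP ->]; exists (- y); first exact: coweightN.
by rewrite scalerN addrK.
Qed.

Lemma alcove_bases_congruent x x' : congruent x x' ->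
  alcove_bases Phi c (perturbed c alpha q x) =
  alcove_bases Phi c (perturbed c alpha q x').
Proof.
move=> [y yP ->]; rewrite -(alcove_bases_translate _ (perturbed _ _ _ x') yP).
congr alcove_bases; rewrite /perturbed addrAC scalerDr scalerK //.
by rewrite pnatr_eq0 -lt0n.
Qed.

End Residues.

(** * Double counting of residue classes and bases *)

Section Count.
Variables (R : realType) (l : nat) (Phi : {fset 'rV[R]_l}) (c : 'I_l -> nat).
Local Notation V := 'rV[R]_l.
Implicit Types (a x p r : V).
Hypothesis rsPhi : root_system Phi.
Variable alpha : 'I_l -> V.
Hypothesis ab : labelled_base Phi c alpha.
Variable q : nat.
Hypothesis q_gt0 : (0 < q)%N.

Local Notation ascent := (ascent alpha).
Local Notation wall_gaps := (wall_gaps c alpha q).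
Local Notation avoids := (avoids Phi alpha q).
Local Notation congruent := (congruent Phi q).
Local Notation pt x := (perturbed c alpha q x).

Lemma congruent_trans x y z : congruent x y -> congruent y z -> congruent x z.
Proof.
move=> [u uP ->] [v vP ->]; exists (v + u); first exact: coweightD.
by rewrite scalerDr addrA.
Qed.

(** Coordinates in [0, q) with respect to the basis dual to alpha give one representative of each
    class of Z(Phi)/qZ(Phi). *)
Definition residue_point (g : {ffun 'I_l -> 'I_q}) : V :=
  dual_comb alpha (fun i => (g i)%:R).

Lemma coweight_residue_point g : coweight Phi (residue_point g).
Proof.
by apply/(coweightP rsPhi _ ab) => i; rewrite (dual_combE ab) natr_int.
Qed.

Lemma residue_point_exists x : coweight Phi x ->
  exists g, congruent x (residue_point g).
Proof.
move=> xP; have [aP _ _ _] := ab.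
have [k xk] : {k : 'I_l -> int & forall i, dot (alpha i) x = (k i)%:~R}.
  by apply: (@choice _ _ (fun i k => dot (alpha i) x = k%:~R)) => i; apply/intrP/xP.
have kq i : (`|(k i %% q)%Z| < q)%N.
  by have := @ltz_mod (k i) q; have := @modz_ge0 (k i) q; lia.
exists [ffun i => Ordinal (kq i)]; apply/(congruentP rsPhi ab) => i.
exists (k i %/ q)%Z; rewrite (dual_combE ab) xk ffunE /= !pmulrn -intrM -intrD.
congr _%:~R; rewrite gez0_abs; last by apply: modz_ge0; lia.
by rewrite addrC -divz_eq.
Qed.

Lemma residue_point_inj g g' :
  congruent (residue_point g) (residue_point g') -> g = g'.
Proof.
move=> /(congruentP rsPhi ab) gg; apply/ffunP => i; apply: val_inj.
have [m] := gg i; rewrite !(dual_combE ab) !pmulrn -intrM -intrD => /eqP.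
rewrite eqr_int /= => /eqP; have := ltn_ord (g i); have := ltn_ord (g' i).
move: (nat_of_ord (g i)) (nat_of_ord (g' i)) => u v /= vq uq uv.
have m1 : m <= 0 by rewrite leNgt; apply/negP => ?; nia.
have m0 : 0 <= m by rewrite leNgt; apply/negP => ?; nia.
have mE : m = 0 by lia.
by move: uv; rewrite mE; lia.
Qed.

Definition avoiding n : {set {ffun 'I_l -> 'I_q}} :=
  [set g | `[< avoids n (residue_point g) >]].

(** The inequalities of [wall_gaps] in the coordinates dual to b. The coordinates are at most q
    because the marks are positive. *)
Definition gap_labels (b : 'I_l -> V) n : {set {ffun 'I_l -> 'I_q.+1}} :=
  [set y : {ffun 'I_l -> 'I_q.+1} |
    [forall i, n.+1 * ascent (b i) <= y i]%N &&
    (\sum_i c i * y i + n.+1 * ascent (- nat_comb b c) <= q)%N].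

Section OneBase.
Variable b : 'I_l -> V.
Hypothesis bb : labelled_base Phi c b.

Definition label_point (y : {ffun 'I_l -> 'I_q.+1}) : V :=
  dual_comb b (fun i => (y i)%:R).

Lemma coweight_label_point y : coweight Phi (label_point y).
Proof.
by apply/(coweightP rsPhi _ bb) => i; rewrite (dual_combE bb) natr_int.
Qed.

Lemma wall_gaps_label_point n y :
  wall_gaps b n (label_point y) <-> y \in gap_labels b n.
Proof.
have S : dot (nat_comb b c) (label_point y) = (\sum_i c i * y i)%:R.
  rewrite dot_nat_comb natr_sum; apply: eq_bigr => i _.
  by rewrite (dual_combE bb) natrM.
rewrite finset.in_set /wall_gaps S -natrD ler_nat.
split=> [[yi ->]|/andP [/forallP yi ->]].
  rewrite andbT; apply/forallP => i.
  by have := yi i; rewrite (dual_combE bb) ler_nat.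
by split=> // i; rewrite (dual_combE bb) ler_nat.
Qed.

Lemma wall_gaps0 n x : wall_gaps b n x -> wall_gaps b 0 x.
Proof.
move=> [g1 g2]; split=> [i|]; first by apply: le_trans (g1 i); rewrite ler_nat leq_mul.
by apply: le_trans g2; rewrite lerD2l ler_nat leq_mul.
Qed.

Lemma label_point_exists x : coweight Phi x -> (forall i, 0 <= dot (b i) x) ->
  dot (nat_comb b c) x <= q%:R -> exists y, x = label_point y.
Proof.
move=> xP x0 xq; have [bP _ _ _] := bb.
have [k xk] : {k : 'I_l -> int & forall i, dot (b i) x = (k i)%:~R}.
  by apply: (@choice _ _ (fun i k => dot (b i) x = k%:~R)) => i; apply/intrP/xP.
have k0 i : 0 <= k i by rewrite -(ler0z R) -xk.
have kq i : (`|k i|%N < q.+1)%N.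
  suff : dot (b i) x <= q%:R by rewrite xk pmulrn ler_int ltnS -lez_nat gez0_abs.
  apply: le_trans xq; rewrite dot_nat_comb (bigD1 i) //= ler_wpDr //.
    by apply: sumr_ge0 => j _; rewrite mulr_ge0 ?ler0n.
  by rewrite ler_peMl // ler1n (marks_gt0 rsPhi i bb).
exists [ffun i => Ordinal (kq i)]; apply: (dot_base_inj bb) => i.
by rewrite (dual_combE bb) xk ffunE /= pmulrn gez0_abs.
Qed.

(** The perturbed points differ by a coweight, on which each [b i] takes an integral value of
    modulus less than 1. *)
Lemma in_alcove_congruent x y : congruent x y -> in_alcove c b (pt x) ->
  in_alcove c b (pt y) -> x = y.
Proof.
move=> [z zP xyz] bx by_; suff z0 : z = 0 by rewrite xyz z0 scaler0 addr0.
have [bP _ _ _] := bb.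
have ptx : pt x = pt y + z.
  by rewrite /perturbed xyz addrAC scalerDr scalerK // pnatr_eq0 -lt0n.
apply: (dot_base_inj bb) => i; rewrite dot0r.
have := zP _ (bP i) => /intrP [k zk].
have := root_in_alcove rsPhi bb (bP i).
case=> H; have /andP [] := H _ bx; have /andP [] := H _ by_;
  rewrite ptx dotDr zk => ? ? ? ?.
  have : k%:~R < 1%:~R :> R by lra.
  have : (-1)%:~R < k%:~R :> R by rewrite intrN; lra.
  by rewrite !ltr_int => ? ?; have -> : k = 0%:Z by lia.
have : k%:~R < 1%:~R :> R by lra.
have : (-1)%:~R < k%:~R :> R by rewrite intrN; lra.
by rewrite !ltr_int => ? ?; have -> : k = 0%:Z by lia.
Qed.

End OneBase.

(** Once b is fixed, a class has at most one representative whose perturbed point lies in the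
    fundamental alcove of b. The coordinates of this representative are the label, and [avoidsP]
    translates avoidance into gaps. *)
Lemma card_gap_labels n (b : {ffun 'I_l -> Phi}) :
  labelled_base Phi c (fun i => fsval (b i)) ->
  #|[set g in avoiding n | b \in alcove_bases Phi c (pt (residue_point g))]| =
  #|gap_labels (fun i => fsval (b i)) n|.
Proof.
move=> bb; set b' := fun i => _ in bb *.
have [phi phiP] := choice (fun y => residue_point_exists (coweight_label_point bb y)).
have gaps0 y : y \in gap_labels b' n -> in_alcove c b' (pt (label_point b' y)).
  move=> yG; apply/(in_alcove_perturbed rsPhi ab q_gt0 bb (coweight_label_point bb y)).
  by apply: (@wall_gaps0 _ n); apply/(wall_gaps_label_point bb).
rewrite -[RHS](@card_in_imset _ _ phi) => [|y y' yG y'G e]; last first.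
  have : label_point b' y = label_point b' y'.
    apply: (in_alcove_congruent bb) (gaps0 _ yG) (gaps0 _ y'G).
    apply: congruent_trans (phiP y) _; rewrite e.
    exact/congruent_sym/phiP.
  move=> e'; apply/ffunP => i; apply: val_inj; apply/eqP.
  rewrite -(eqr_nat R) /=; apply/eqP.
  by have := congr1 (dot (b' i)) e'; rewrite !(dual_combE bb).
apply: eq_card => g; apply/idP/imsetP.
  rewrite !finset.in_set => /andP [/asboolP av /asboolP [_ [z zP bz]]].
  (* After division by q, this representative becomes the translate by - z that lies in the
     fundamental alcove of b. *)
  pose x := residue_point g - q%:R *: z.
  have ptx : pt (residue_point g) - z = pt x.
    rewrite /perturbed /x [_ - q%:R *: z - _]addrAC [in RHS]scalerBr.
    by rewrite scalerK // pnatr_eq0 -lt0n.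
  have xP : coweight Phi x.
    apply: coweightB (coweight_residue_point g) _.
    by apply: coweightZ => //; apply: natr_int.
  have xg : congruent x (residue_point g).
    by exists (- z); [apply: coweightN|rewrite scalerN].
  rewrite ptx in bz; move/(in_alcove_perturbed rsPhi ab q_gt0 bb xP): bz => g0.
  have gn : wall_gaps b' n x.
    by apply/(avoidsP rsPhi ab) => //; apply: (avoids_congruent rsPhi ab xg).
  have [y xy] : exists y, x = label_point b' y.
    apply: label_point_exists => // [i|]; first exact: wall_gaps_ge0 gn.
    by case: gn => _; apply: le_trans; rewrite lerDl.
  exists y; first by apply/(wall_gaps_label_point bb); rewrite -xy.
  apply: residue_point_inj; apply: congruent_trans (congruent_sym xg) _.
  by rewrite xy; apply: phiP.
move=> [y yG ->]; rewrite !finset.in_set; apply/andP; split; apply/asboolP.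
  apply: (avoids_congruent rsPhi ab (congruent_sym (phiP y))).
  have yW : wall_gaps b' n (label_point b' y) by apply/(wall_gaps_label_point bb).
  have yC := coweight_label_point bb y.
  exact/(avoidsP rsPhi ab q_gt0 _ bb yC (wall_gaps0 yW)).
apply/alcove_basesP.
rewrite -(alcove_bases_congruent _ _ q_gt0 (phiP y)); apply/alcove_basesP.
split=> //; exists 0; last by rewrite subr0; apply: gaps0.
by move=> r _; rewrite dot0r rpred0.
Qed.

(** The pairs of an avoiding class g and a base of its alcove are counted in both orders; every g
    has [base_number] bases. *)
Lemma avoiding_count n :
  (base_number Phi c alpha * #|avoiding n| =
   \sum_(b : {ffun 'I_l -> Phi} | `[< labelled_base Phi c (fun i => fsval (b i)) >])
     #|gap_labels (fun i => fsval (b i)) n|)%N.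
Proof.
transitivity (\sum_(g in avoiding n)
    \sum_(b in alcove_bases Phi c (pt (residue_point g))) 1)%N.
  rewrite mulnC -sum_nat_const; apply: eq_bigr => g _.
  rewrite sum1_card (card_alcove_bases_perturbed rsPhi ab q_gt0) //.
  exact: coweight_residue_point.
rewrite (exchange_big_dep (fun b : {ffun 'I_l -> Phi} =>
  `[< labelled_base Phi c (fun i => fsval (b i)) >])) /= => [|g b _]; last first.
  by move=> /alcove_basesP [bb _]; apply/asboolP.
apply: eq_bigr => b /asboolP bb; rewrite -card_gap_labels // -sum1_card.
by apply: eq_bigl => g; rewrite [RHS]finset.in_set.
Qed.

End Count.

(** * Quasi-polynomials *)

Section QuasiPoly.
Variable R : realType.
Local Notation C := R[i].
Implicit Types f g : int -> C.

Lemma poly_inf_roots (p : {poly C}) (u : nat -> C) : injective u ->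
  (forall k, root p (u k)) -> p = 0.
Proof.
move=> uI pu; apply/eqP; rewrite -[_ == 0]negbK; apply/negP => p0.
have := max_poly_roots p0 (rs := mkseq u (size p)).
rewrite size_mkseq ltnn => H; suff : false by [].
apply: H; last by rewrite mkseq_uniq.
by apply/allP => _ /mapP [k _ ->].
Qed.

Lemma poly_eq_progression (p p' : {poly C}) (t P : int) q0 : 0 < P ->
  (forall k : nat, (q0 < k)%N ->
     p.[(t + k%:Z * P)%:~R] = p'.[(t + k%:Z * P)%:~R]) -> p = p'.
Proof.
move=> P0 H; apply/eqP; rewrite -subr_eq0; apply/eqP.
apply: (@poly_inf_roots _ (fun k => (t + (q0.+1 + k)%:Z * P)%:~R)) => [i j|k].
  by move=> /eqP; rewrite eqr_int => /eqP; nia.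
by rewrite /root hornerD hornerN H ?subrr //; lia.
Qed.

Lemma has_period_mul f p q : has_period f p -> (0 < q)%N -> has_period f (p * q)%N.
Proof.
move=> [p0 [g fg]] q0; split; first by rewrite muln_gt0 p0.
exists (fun s => g (s %% p)%Z) => t.
rewrite fg {1}(divz_eq t (p * q)%N); set u := (t %/ _)%Z; set v := (t %% _)%Z.
by rewrite (_ : u * _ = u * q%:Z * p%:Z) ?modzMDl // PoszM mulrCA mulrC.
Qed.

(** Over a common period, the two constituents of each residue class agree at infinitely many
    integers. *)
Lemma quasi_polynomial_unique f f' q0 : quasi_polynomial f ->
  quasi_polynomial f' ->
  (forall q : nat, (q0 < q)%N -> f q%:Z = f' q%:Z) -> f = f'.
Proof.
move=> [p fp] [p' fp'] ff'; have [p0 _] := fp; have [p'0 _] := fp'.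
have := has_period_mul fp p'0; have := has_period_mul fp' p0.
rewrite mulnC; move: (p * p')%N => P {p fp p' fp' p0 p'0} [P0 [g' fg']] [_ [g fg]].
apply: funext => t; rewrite fg fg'; congr _.[_].
apply: (@poly_eq_progression _ _ t P (q0 + `|t|)) => [|k kq]; first by lia.
have E : (t + k%:Z * P%:Z = t %[mod P%:Z])%Z by rewrite addrC modzMDl.
have [q qE] : exists q : nat, t + k%:Z * P%:Z = q by exists `|(t + k%:Z * P%:Z)%R|%N; nia.
by have := ff' q; rewrite fg fg' -qE E; apply; nia.
Qed.

Lemma has_period_sum (I : finType) (A : pred I) (F : I -> int -> C) p :
  (0 < p)%N -> (forall i, A i -> has_period (F i) p) ->
  has_period (fun t => \sum_(i | A i) F i t) p.
Proof.
move=> p0 Fp; split => //.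
have [G FG] : {G : I -> int -> {poly C} & forall i, A i ->
    forall t, F i t = (G i (t %% p%:Z)%Z).[t%:~R]}.
  apply: (@choice _ _ (fun i (G : int -> {poly C}) => A i ->
    forall t, F i t = (G (t %% p%:Z)%Z).[t%:~R])) => i.
  case Ai: (A i); last by exists (fun=> 0).
  by have [_ [g Fg]] := Fp _ Ai; exists g.
exists (fun s => \sum_(i | A i) G i s) => t.
by rewrite horner_sum; apply: eq_bigr => i /FG ->.
Qed.

Lemma has_periodZ f p a : has_period f p -> has_period (fun t => a * f t) p.
Proof.
by move=> [p0 [g fg]]; split=> //; exists (fun s => a *: g s) => t; rewrite hornerZ fg.
Qed.

Lemma has_periodB f f' p : has_period f p -> has_period f' p ->
  has_period (fun t => f t - f' t) p.
Proof.
move=> [p0 [g fg]] [_ [g' fg']]; split=> //; exists (fun s => g s - g' s) => t.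
by rewrite hornerD hornerN fg fg'.
Qed.

Lemma has_period_shift f p (a : int) : has_period f p ->
  has_period (fun t => f (t - a)) p.
Proof.
move=> [p0 [g fg]]; split=> //.
exists (fun s => g ((s - a) %% p%:Z)%Z \Po ('X - a%:~R%:P)) => t.
rewrite fg horner_comp !hornerE -intrB; congr (g _).[_].
by rewrite modzDml.
Qed.

Lemma minimal_periodP f : quasi_polynomial f -> has_period f (minimal_period f).
Proof.
move=> [p fp]; rewrite /minimal_period.
pose A := [set p | has_period f p /\ forall p', has_period f p' -> (p <= p')%N]%classic.
suff : A (xget 0%N A) by case.
apply: xgetPex; have [q fq qmin] :=
  @arg_minnP _ (Ordinal (ltnSn p)) (fun q : 'I_p.+1 => `[< has_period f q >])
    (fun q => q) (introT (asboolP _) fp).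
exists (val q); split=> [|p' fp']; first exact/asboolP.
have [p'p|pp'] := ltnP p' p.+1.
  by apply: (qmin (Ordinal p'p)); apply/asboolP.
by apply: (leq_trans _ pp'); apply/ltnW/ltn_ord.
Qed.

End QuasiPoly.

(** * Removal of the congruence condition when m is coprime to the period *)

Section Dilation.
Variables (R : realType) (l m rho : nat).
Local Notation C := R[i].
Variables (J : finType) (A : pred J) (a : J -> nat) (N : C).
Variables (w : 'I_l.+1 -> nat) (L : int -> C) (q0 : nat).
Hypotheses (m_gt0 : (0 < m)%N) (m_rho : coprime m rho) (N_neq0 : N != 0).
Hypothesis L_period : has_period L rho.

Let wr (r : {ffun 'I_l.+1 -> 'I_m}) : nat := (\sum_j w j * r j)%N.

Hypothesis L_worpitzky : forall q : nat, (q0 < q)%N ->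
  \sum_(b | A b) L (q%:Z - (a b)%:Z) = N * q%:R ^+ l.
Hypothesis L_dilation : forall q : nat, (q0 < q)%N ->
  L q%:Z = \sum_r (if (m %| q%:Z - (wr r)%:Z)%Z
                   then L ((q%:Z - (wr r)%:Z) %/ m)%Z else 0).

Let rho_gt0 : (0 < rho)%N. Proof. by case: L_period. Qed.

(** Both sides are quasi-polynomials in t. The extension to all integers serves the quotients by m
    below, which may be small or negative. *)
Lemma worpitzky_int (t : int) :
  \sum_(b | A b) L (t - (a b)%:Z) = N * t%:~R ^+ l.
Proof.
have : (fun t => \sum_(b | A b) L (t - (a b)%:Z)) =
       (fun t : int => N * t%:~R ^+ l :> C).
  apply: (@quasi_polynomial_unique _ _ _ q0).
  - exists rho; apply: has_period_sum => // b _; exact: has_period_shift.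
  - exists 1%N; apply: has_periodZ; split => //; exists (fun=> 'X^l) => s.
    by rewrite hornerXn.
  by move=> q /L_worpitzky.
by move/(congr1 (fun f => f t)).
Qed.

Lemma dilated_worpitzky_large : exists q1, forall q : nat, (q1 < q)%N ->
  \sum_(b | A b) L (q%:Z - m%:Z * (a b)%:Z) = N * \sum_r
    (if (m %| q%:Z - (wr r)%:Z)%Z
     then ((q%:Z - (wr r)%:Z) %/ m)%Z%:~R ^+ l else 0).
Proof.
exists (q0 + \sum_b m * a b)%N => q qq1.
have qb b : exists2 q' : nat, q%:Z - m%:Z * (a b)%:Z = q' & (q0 < q')%N.
  have : (m * a b <= \sum_b m * a b)%N by rewrite (bigD1 b) //= leq_addr.
  by exists (q - m * a b)%N; lia.
transitivity (\sum_(b | A b) \sum_r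
    (if (m %| q%:Z - (wr r)%:Z)%Z
     then L (((q%:Z - (wr r)%:Z) %/ m)%Z - (a b)%:Z) else 0)).
  apply: eq_bigr => b _; have [q' qE q'0] := qb b.
  rewrite qE L_dilation // -qE; apply: eq_bigr => r _.
  (* Shifting by a multiple of m leaves the divisibility condition unchanged and moves the quotient
     by [a b], so that Worpitzky's identity applies to each r separately. *)
  have -> : q%:Z - m%:Z * (a b)%:Z - (wr r)%:Z =
            (- (a b)%:Z) * m%:Z + (q%:Z - (wr r)%:Z) by ring.
  rewrite rpredDl ?dvdz_mull // divzMDl; last by lia.
  by rewrite [- _ + _]addrC.
rewrite exchange_big mulr_sumr; apply: eq_bigr => r _.
case: ifP => _; last by rewrite mulr0 big1.
exact: worpitzky_int.
Qed.

(* m^(l+1) times the difference of the two sides of [dilated_worpitzky] is given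
   at t by the constituent G (t mod m); having also period rho, it is a polynomial,
   so the constituents agree, and their sum over the residues vanishes. *)
Let G (s : int) : {poly C} := \sum_r
  (if (m %| s - (wr r)%:Z)%Z then m%:R - 1 else - 1) *: ('X - (wr r)%:R%:P) ^+ l.

(** For each r exactly one residue s is congruent to [wr r]; it contributes m - 1 and the other m -
    1 residues contribute -1 each. *)
Let sum_G : \sum_(s < m) G s%:Z = 0.
Proof.
rewrite /G exchange_big big1 //= => r _; rewrite -scaler_suml.
rewrite (_ : \sum_(s < m) _ = 0) ?scale0r //.
have wm : (wr r %% m < m)%N by rewrite ltn_mod.
rewrite (bigD1 (Ordinal wm)) //= (eq_bigr (fun=> -1)) => [|s sw].
  rewrite (_ : (m %| _)%Z = true); last first.
    by rewrite /= -eqz_mod_dvd !modz_nat modn_mod eqxx.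
  rewrite sumr_const cardC1 card_ord mulNrn.
  by rewrite -subn1 natrB // subrr.
case: ifP => //; rewrite -eqz_mod_dvd !modz_nat modn_small // => /eqP [ss].
by case/eqP: sw; apply: val_inj.
Qed.

Lemma dilated_worpitzky (t : int) :
  \sum_(b | A b) L (t - m%:Z * (a b)%:Z) =
  N * (m%:R ^- l.+1 * \sum_r (t - (wr r)%:Z)%:~R ^+ l).
Proof.
pose Q (t : int) : C := N^-1 * (m%:R ^+ l.+1) * \sum_(b | A b) L (t - m%:Z * (a b)%:Z)
  - \sum_r (t - (wr r)%:Z)%:~R ^+ l.
have m0 : m%:R != 0 :> C by rewrite pnatr_eq0 -lt0n.
have Qrho : has_period Q rho.
  apply: has_periodB.
    by apply: has_periodZ; apply: has_period_sum => // b _; apply: has_period_shift.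
  apply: has_period_sum => // r _; split=> //.
  exists (fun=> ('X - (wr r)%:R%:P) ^+ l) => s.
  by rewrite horner_exp !hornerE intrB -pmulrn.
have Gm : has_period (fun t => (G (t %% m)%Z).[t%:~R]) m by split=> //; exists G.
have QG : Q = fun t => (G (t %% m)%Z).[t%:~R].
  have [q1 H] := dilated_worpitzky_large.
  apply: (@quasi_polynomial_unique _ _ _ q1); [by exists rho|by exists m|].
  move=> q qq1; rewrite /Q H // mulrACA mulVf // mul1r.
  rewrite mulr_sumr -sumrB horner_sum; apply: eq_bigr => r _.
  rewrite hornerZ horner_exp !hornerE.
  have -> : (m %| (q %% m)%Z - (wr r)%:Z)%Z = (m %| q%:Z - (wr r)%:Z)%Z.
    by rewrite -!eqz_mod_dvd modz_mod.
  case: ifP => mr; last by rewrite mulr0 sub0r mulN1r intrB -!pmulrn.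
  rewrite mulrBl mul1r intrB -!pmulrn; congr (_ - _).
  rewrite exprS -mulrA -exprMn; congr (_ * _ ^+ _).
  by rewrite !pmulrn -intrM mulrC divzK // intrB -!pmulrn.
have [_ [g Qg]] := Qrho.
(* By the Chinese remainder theorem some progression of step m rho is s modulo m and 0 modulo rho;
   along it both descriptions of Q hold. *)
have GE (s : int) : G (s %% m)%Z = g 0.
  pose u := zchinese m rho s 0.
  have us : (u = s %[mod m])%Z by apply: zchinese_modl.
  have u0 : (u = 0 %[mod rho])%Z by apply: zchinese_modr.
  apply: (@poly_eq_progression _ _ _ u (m * rho)%N 0).
    by rewrite ltz_nat muln_gt0 m_gt0.
  move=> k _; set t' := u + _.
  have t's : (t' %% m)%Z = (s %% m)%Z.
    by rewrite /t' addrC PoszM mulrCA mulrC modzMDl.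
  have t'0 : (t' %% rho)%Z = 0.
    by rewrite /t' addrC PoszM mulrA modzMDl u0 mod0z.
  by have := congr1 (fun f => f t') QG; rewrite /= Qg t's t'0.
have G0 : g 0 = 0.
  have : \sum_(s < m) G s%:Z = (g 0) *+ m.
    rewrite (eq_bigr (fun=> g 0)) ?sumr_const ?card_ord // => s _.
    by rewrite -(GE s) modz_small //= ltz_nat ltn_ord.
  rewrite sum_G => /esym /eqP; rewrite -scaler_nat scaler_eq0 (negPf m0) /=.
  by move/eqP.
have := congr1 (fun f => f t) QG; rewrite /= GE G0 horner0 /Q => /eqP.
rewrite subr_eq0 => /eqP <-; move: (\sum_(b | A b) _) => S.
by rewrite -[_ * _ * S]mulrA (mulrCA _ N^-1) mulVKf // mulKf ?expf_neq0.
Qed.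

End Dilation.

(** * Solutions of linear equations in natural numbers *)

Section Brackets.
Variable F : fieldType.
Implicit Types (p q : {poly F}) (m n k : nat).

Lemma bracketD (x : {poly F}) m n :
  bracket (m + n) x = bracket m x + x ^+ m * bracket n x.
Proof.
rewrite /bracket big_split_ord mulr_sumr; congr (_ + _).
by apply: eq_bigr => i _; rewrite -exprD.
Qed.

Lemma bracketM (x : {poly F}) m n :
  bracket (n * m) x = bracket m x * bracket n (x ^+ m).
Proof.
elim: n => [|n IH]; first by rewrite mul0n /bracket !big_ord0 mulr0.
rewrite mulSn bracketD IH -[n.+1]add1n bracketD expr1.
by rewrite [bracket 1 _]big_ord1 expr0 mulrDr mulr1 mulrCA.
Qed.

Lemma coef_bracketXn n k i : (0 < k)%N ->
  (bracket n ('X^k : {poly F}))`_i = ((k %| i)%N && (i %/ k < n)%N)%:R.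
Proof.
move=> k0; rewrite coef_sum.
case kn: (_ && _).
  have /andP [ki ikn] := kn; rewrite (bigD1 (Ordinal ikn)) //= -exprM coefXn.
  rewrite mulnC divnK // eqxx big1 ?addr0 // => j ji.
  rewrite -exprM coefXn; case: eqP => // ikj; case/eqP: ji; apply: val_inj.
  by rewrite /= ikj mulKn.
rewrite big1 // => j _; rewrite -exprM coefXn; case: eqP => // ikj.
by move: kn; rewrite ikj dvdn_mulr // mulKn // ltn_ord.
Qed.

Definition eq_upto t p q := forall i, (i <= t)%N -> p`_i = q`_i.

Lemma eq_uptoM t p p' q q' :
  eq_upto t p p' -> eq_upto t q q' -> eq_upto t (p * q) (p' * q').
Proof.
move=> pp qq i it; rewrite !coefM; apply: eq_bigr => j _.
have ji := ltn_ord j; rewrite ltnS in ji.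
by rewrite pp ?qq //; apply: leq_trans it => //; apply: leq_subr.
Qed.

Lemma eq_upto_prod t (I : finType) (P Q : I -> {poly F}) :
  (forall i, eq_upto t (P i) (Q i)) -> eq_upto t (\prod_i P i) (\prod_i Q i).
Proof.
move=> PQ; apply: (big_ind2 (eq_upto t)) => //.
by move=> *; apply: eq_uptoM.
Qed.

End Brackets.

Section Counting.
Variable F : fieldType.

(* The coefficient counts the solutions of [\sum_j w j * y j = t] in natural
   numbers; truncating each geometric series after exponent t is harmless. *)
Definition solutions k (w : 'I_k -> nat) (t : nat) : F :=
  (\prod_j bracket t.+1 ('X^(w j) : {poly F}))`_t.

Variables (k : nat) (w : 'I_k -> nat).
Hypothesis w_gt0 : forall j, (0 < w j)%N.

(** Terms of exponent above t do not reach the coefficient of index t, so each series may be cut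
    anywhere beyond t. *)
Lemma solutionsE (N : 'I_k -> nat) t : (forall j, t < N j)%N ->
  solutions w t = (\prod_j bracket (N j) ('X^(w j) : {poly F}))`_t.
Proof.
move=> tN; apply: (@eq_upto_prod _ t) => // j i it; rewrite !coef_bracketXn //.
have -> // : (i %/ w j < t.+1)%N; first by rewrite ltnS (leq_trans (leq_div _ _)).
have -> // : (i %/ w j < N j)%N.
by rewrite (leq_ltn_trans (leq_div _ _)) // (leq_ltn_trans it).
Qed.

Lemma prod_bracketXn m (v : 'I_k -> nat) :
  \prod_j bracket m ('X^(v j) : {poly F}) =
  \sum_(r : {ffun 'I_k -> 'I_m}) 'X^(\sum_j v j * r j).
Proof.
rewrite /bracket bigA_distr_bigA; apply: eq_bigr => r _.
by rewrite -prodrXr; apply: eq_bigr => j _; rewrite exprM.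
Qed.

Lemma bracketXn_comp n m v : (0 < m)%N ->
  bracket n ('X^(v * m) : {poly F}) = bracket n 'X^v \Po 'X^m.
Proof.
move=> m0; rewrite /bracket (raddf_sum (comp_poly _)); apply: eq_bigr => i _.
by rewrite /= -!exprM comp_Xn_poly -exprM; congr ('X^_); ring.
Qed.

(** Each unknown is divided by m with remainder r. On generating functions this is [bracketM] for a
    truncation length divisible by m. *)
Lemma solutions_dilation m t : (0 < m)%N ->
  solutions w t = \sum_(r : {ffun 'I_k -> 'I_m})
    (let s := (\sum_j w j * r j)%N in
     if (s <= t)%N && (m %| t - s)%N then solutions w ((t - s) %/ m) else 0).
Proof.
move=> m0; rewrite (solutionsE (N := fun=> (t.+1 * m)%N)); last first.
  by move=> j; rewrite leq_pmulr.
under eq_bigr do rewrite bracketM -exprM bracketXn_comp //.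
rewrite big_split /= prod_bracketXn -rmorph_prod /= mulr_suml coef_sum.
apply: eq_bigr => r _; rewrite mulrC coefMXn ltnNge; case: leqP => //= st.
rewrite coef_comp_poly_Xn //; case: ifP => // _.
by rewrite -solutionsE // => _; rewrite ltnS (leq_trans (leq_div _ _)) ?leq_subr.
Qed.

End Counting.

(** The weight 1 at index 0 of [ext_coef] belongs to the slack variable that turns the inequality
    into an equation. *)
Lemma card_bounded_solutions (F : fieldType) l (c : 'I_l -> nat) N t :
  (forall i, 0 < c i)%N -> (t < N)%N ->
  #|[set y : {ffun 'I_l -> 'I_N} | (\sum_i c i * y i <= t)%N]|%:R =
  solutions F (ext_coef c) t.
Proof.
move=> c0 tN; have ec0 j : (0 < ext_coef c j)%N by rewrite /ext_coef; case: unliftP.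
rewrite (solutionsE F ec0 (N := fun=> N)) // big_ord_recl.
under eq_bigr do rewrite /ext_coef liftK.
rewrite /ext_coef unlift_none prod_bracketXn mulr_sumr coef_sum.
rewrite -sum1_card natr_sum big_mkcond; apply: eq_bigr => y _.
rewrite finset.in_set coefMXn ltnNge; case: leqP => //= st.
rewrite coef_bracketXn // dvd1n divn1.
by rewrite (leq_ltn_trans (leq_subr _ _) tN).
Qed.

Lemma hockey_stick n t : (\sum_(j < t.+1) 'C(j + n, n) = 'C(t + n.+1, n.+1))%N.
Proof.
elim: t => [|t IH]; first by rewrite big_ord1 add0n !binn.
by rewrite big_ord_recr /= IH addSnnS [(t.+1 + _)%N]addSn binS.
Qed.

Lemma bin_prod n s : ('C(s + n, n) * n`! = \prod_(k < n) (s + k.+1))%N.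
Proof.
elim: n => [|n IH]; first by rewrite bin0 big_ord0.
rewrite big_ord_recr /= -IH factS mulnA [(_ * n.+1)%N]mulnC addnS.
by rewrite -mul_bin_diag -mulnA [RHS]mulnC.
Qed.

(** * Quasi-polynomiality of the number of solutions *)

Section EhrhartQuasi.
Variable R : realType.
Local Notation C := R[i].

Definition bin_poly n : {poly C} := (n`!)%:R^-1 *: \prod_(k < n) ('X + k.+1%:R%:P).

Lemma bin_polyE n (s : nat) : (bin_poly n).[s%:R] = ('C(s + n, n))%:R.
Proof.
have n0 : (n`!)%:R != 0 :> C by rewrite pnatr_eq0 -lt0n fact_gt0.
apply: (mulIf n0); rewrite -natrM bin_prod /bin_poly hornerZ mulrAC mulVf // mul1r.
rewrite horner_prod natr_prod; apply: eq_bigr => k _.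
by rewrite !hornerE natrD.
Qed.

(** These zeros allow the sum of [solutions_bin] to be extended to indices i > t. *)
Lemma bin_poly_eq0 n (d : nat) : (0 < d <= n)%N -> (bin_poly n).[- d%:R] = 0.
Proof.
case: d => // d dn; rewrite /bin_poly hornerZ horner_prod (bigD1 (Ordinal dn)) //=.
have -> : ('X + d.+1%:R%:P).[- d.+1%:R] = 0 :> C by rewrite !hornerE addNr.
by rewrite mul0r mulr0.
Qed.

Lemma coef_bracketX_exp n N t : (t < N)%N ->
  ((bracket N 'X : {poly C}) ^+ n.+1)`_t = ('C(t + n, n))%:R.
Proof.
elim: n t => [|n IH] t tN.
  by rewrite expr1 -['X]expr1 coef_bracketXn // dvd1n divn1 tN addn0 bin0.
rewrite exprSr coefM -hockey_stick natr_sum; apply: eq_bigr => j _.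
have jt := ltn_ord j; rewrite IH; last by apply: leq_trans tN.
rewrite -['X]expr1 coef_bracketXn // dvd1n divn1.
by rewrite (leq_ltn_trans (leq_subr _ _) tN) mulr1.
Qed.

Lemma size_bracketXn m k : (0 < m)%N ->
  (size (bracket m ('X^k : {poly C})) <= (k * m.-1).+1)%N.
Proof.
move=> m0; apply: (leq_trans (size_sum _ _ _)); apply/bigmax_leqP => i _.
rewrite -exprM size_polyXn ltnS leq_mul //.
by rewrite -ltnS prednK.
Qed.

Variables (l : nat) (w : 'I_l.+1 -> nat).
Hypothesis w_gt0 : forall j, (0 < w j)%N.

Let M := (\prod_j w j)%N.
Let mj j := (M %/ w j)%N.
Let B : {poly C} := \prod_j bracket (mj j) 'X^(w j).

Let M_gt0 : (0 < M)%N. Proof. by apply: prodn_gt0. Qed.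

Let mjE j : (w j * mj j = M)%N.
Proof. by rewrite mulnC divnK // /M (bigD1 j) //= dvdn_mulr. Qed.

Let mj_gt0 j : (0 < mj j)%N.
Proof. by have := M_gt0; rewrite -(mjE j) muln_gt0 => /andP []. Qed.

(** The bound ensures that a multiple of M of the form i - t > 0, with i an exponent of B, is at
    most l M, the range where [bin_poly l] vanishes. *)
Let B_size : (size B <= l.+1 * M)%N.
Proof.
apply: leq_trans (size_prod_leq _ _) _; rewrite leq_subLR cardT size_enum_ord.
rewrite -addn1 addnC leq_add //.
apply: leq_trans (_ : (\sum_(j < l.+1) M <= _)%N); last first.
  by rewrite sum_nat_const card_ord.
apply: leq_sum => j _; apply: leq_trans (size_bracketXn _ (mj_gt0 j)) _.
rewrite -[X in (_ <= X)%N](mjE j) -{2}(prednK (mj_gt0 j)) mulnS addnC -addn1.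
by rewrite leq_add2l.
Qed.

(* 1/prod_j (1 - x^(w j)) = prod_j [M / w j]_(x^(w j)) / (1 - x^M)^(l+1). *)
Lemma solutions_bin t : solutions C w t = \sum_(i < t.+1) B`_i *
  (if (M %| t - i)%N then ('C((t - i) %/ M + l, l))%:R else 0).
Proof.
rewrite (solutionsE C w_gt0 (N := fun j => (t.+1 * mj j)%N)); last first.
  by move=> j; rewrite leq_pmulr.
under eq_bigr do rewrite bracketM -exprM mjE -[in 'X^M](mul1n M) bracketXn_comp //.
rewrite big_split /= -/B prodr_const card_ord -rmorphXn coefM.
apply: eq_bigr => i _; congr (_ * _); rewrite /= coef_comp_poly_Xn // expr1.
case: ifP => // _; apply: coef_bracketX_exp.
by rewrite ltnS (leq_trans (leq_div _ _)) ?leq_subr.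
Qed.

Lemma solutions_quasi_polynomial : exists2 f : int -> C,
  quasi_polynomial f & forall q : nat, f q%:Z = solutions C w q.
Proof.
pose G i (s : int) : {poly C} := if (M %| s - i%:Z)%Z
  then B`_i *: (bin_poly l \Po (M%:R^-1 *: ('X - i%:R%:P))) else 0.
pose g (s : int) := \sum_(i < l.+1 * M) G i s.
have M0 : M%:R != 0 :> C by rewrite pnatr_eq0 -lt0n.
exists (fun t => (g (t %% M)%Z).[t%:~R]); first by exists M; split=> //; exists g.
move=> t; rewrite horner_sum solutions_bin.
(* Both sides are sums of the same terms T, over i < (l + 1) M and over i <= t; [zero_far] and
   [zero_neg] kill the terms in only one range. *)
pose T (i : nat) : C := if (M %| t%:Z - i%:Z)%Z
  then B`_i * (bin_poly l).[(t%:R - i%:R) / M%:R] else 0.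
rewrite (eq_bigr (fun i : 'I_ _ => T i)) => [|i _]; last first.
  rewrite /G /T; have -> : (M %| (t %% M)%Z - i%:Z)%Z = (M %| t%:Z - i%:Z)%Z.
    by rewrite -!eqz_mod_dvd modz_mod.
  case: ifP => _; last by rewrite horner0.
  by rewrite hornerZ horner_comp !hornerE mulrC.
rewrite [RHS](eq_bigr (fun i : 'I_ _ => T i)) => [|i _]; last first.
  have it := ltn_ord i; rewrite ltnS in it.
  rewrite /T subzn // dvdzE /=; case: ifP => // Mti; last by rewrite mulr0.
  by rewrite -bin_polyE -natrB // -{2}(divnK Mti) natrM mulfK.
have zero_far i : (l.+1 * M <= i)%N -> T i = 0.
  move=> Bi; rewrite /T nth_default ?mul0r ?if_same //.
  exact: leq_trans B_size Bi.
have zero_neg i : (t < i)%N -> (i < l.+1 * M)%N -> T i = 0.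
  move=> ti iM; rewrite /T -opprB subzn ?(ltnW ti) // rpredN dvdzE /=.
  case: ifP => // Mit; rewrite -opprB mulNr -natrB ?(ltnW ti) //.
  rewrite -{1}(divnK Mit) natrM mulfK // bin_poly_eq0 ?mulr0 //.
  rewrite divn_gt0 // (dvdn_leq _ Mit) ?subn_gt0 //=.
  rewrite -ltnS ltn_divLR //; apply: leq_ltn_trans iM; apply: leq_subr.
rewrite -!(big_mkord xpredT T).
have [tM|Mt] := leqP t.+1 (l.+1 * M).
  rewrite (big_cat_nat _ tM) //= [X in _ + X = _](_ : _ = 0) ?addr0 //.
  by rewrite big_nat big1 // => i /andP [ti iM]; apply: zero_neg.
rewrite [RHS](big_cat_nat _ (ltnW Mt)) //= [X in _ = _ + X](_ : _ = 0) ?addr0 //.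
by rewrite big_nat big1 // => i /andP [Mi _]; apply: zero_far.
Qed.

End EhrhartQuasi.

(** * The shift operator and roots on a line *)

Section ShiftOperator.
Variable R : realType.
Local Notation C := R[i].
Implicit Types (P Q p : {poly C}) (f : int -> C).

Lemma iter_shift i f t : iter i (@shift R) f t = f (t - i%:Z).
Proof.
elim: i t => [|i IH] t; first by rewrite subr0.
by rewrite iterS /shift IH; congr f; rewrite intS; ring.
Qed.

Lemma shift_polyE N P f t : (size P <= N)%N ->
  shift_poly P f t = \sum_(i < N) P`_i * f (t - i%:Z).
Proof.
move=> PN; rewrite /shift_poly; under eq_bigr do rewrite iter_shift.
rewrite -!(big_mkord xpredT (fun i => P`_i * f (t - i%:Z))).
rewrite [RHS](big_cat_nat _ PN) //= [X in _ = _ + X](_ : _ = 0) ?addr0 //.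
by rewrite big_nat big1 // => i /andP [Pi _]; rewrite nth_default ?mul0r.
Qed.

(** Expanding the product gives one power of the shift, with exponent w.r, for each r. *)
Lemma shift_poly_prod_bracket l m (w : 'I_l.+1 -> nat) f t :
  shift_poly (\prod_j (m%:R^-1 *: bracket m ('X^(w j)))) f t =
  m%:R ^- l.+1 * \sum_(r : {ffun 'I_l.+1 -> 'I_m}) f (t - (\sum_j w j * r j)%N%:Z).
Proof.
rewrite scaler_prod prodr_const card_ord exprVn prod_bracketXn.
set Q := _ *: _.
pose N := (maxn (size Q) (\max_(r : {ffun 'I_l.+1 -> 'I_m}) (\sum_j w j * r j)).+1)%N.
rewrite (@shift_polyE N) ?leq_maxl // mulr_sumr.
transitivity (\sum_(i < N) \sum_(r : {ffun 'I_l.+1 -> 'I_m})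
    m%:R ^- l.+1 * ((i == (\sum_j w j * r j)%N :> nat)%:R * f (t - i%:Z))).
  apply: eq_bigr => i _; rewrite /Q coefZ coef_sum -mulrA mulr_suml mulr_sumr.
  by apply: eq_bigr => r _; rewrite coefXn.
rewrite exchange_big; apply: eq_bigr => r _ /=; rewrite -mulr_sumr; congr (_ * _).
have rN : ((\sum_j w j * r j) < N)%N.
  rewrite leq_max ltnS; apply/orP; right.
  exact: (leq_bigmax (F := fun r : {ffun 'I_l.+1 -> 'I_m} => (\sum_j w j * r j)%N)).
move: (\sum_j _)%N rN => s rN.
rewrite (bigD1 (Ordinal rN)) //= eqxx mul1r big1 ?addr0 // => i ir.
case: eqP => [e|]; last by rewrite mul0r.
by case/eqP: ir; apply: val_inj.
Qed.

(** The operator [shift_poly] on polynomials instead of functions on the integers, so that complex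
    roots make sense. *)
Definition poly_shift P p : {poly C} :=
  \sum_(i < size P) P`_i *: (p \Po ('X - i%:R%:P)).

Lemma poly_shift_horner P p t :
  (poly_shift P p).[t%:~R] = shift_poly P (fun s => p.[s%:~R]) t.
Proof.
rewrite horner_sum; apply: eq_bigr => i _.
by rewrite iter_shift hornerZ horner_comp !hornerE intrB -pmulrn.
Qed.

Lemma poly_shiftE N P p : (size P <= N)%N ->
  poly_shift P p = \sum_(i < N) P`_i *: (p \Po ('X - i%:R%:P)).
Proof.
move=> PN; rewrite /poly_shift.
rewrite -!(big_mkord xpredT (fun i => P`_i *: (p \Po ('X - i%:R%:P)))).
rewrite [RHS](big_cat_nat _ PN) //= [X in _ = _ + X](_ : _ = 0) ?addr0 //.
by rewrite big_nat big1 // => i /andP [Pi _]; rewrite nth_default ?scale0r.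
Qed.

Lemma poly_shiftZ k P p : poly_shift (k *: P) p = k *: poly_shift P p.
Proof.
rewrite (poly_shiftE _ (size_scale_leq k P)) scaler_sumr.
by apply: eq_bigr => i _; rewrite coefZ scalerA.
Qed.

Lemma poly_shiftB P Q p : poly_shift (P - Q) p = poly_shift P p - poly_shift Q p.
Proof.
pose N := maxn (size P) (size Q).
have PQN : (size (P - Q)%R <= N)%N by rewrite (leq_trans (size_polyD _ _)) ?size_polyN.
rewrite (poly_shiftE _ PQN) !(@poly_shiftE N) ?leq_maxl ?leq_maxr // -sumrB.
by apply: eq_bigr => i _; rewrite coefB scalerBl.
Qed.

Lemma poly_shiftMX P p :
  poly_shift ('X * P) p = poly_shift P p \Po ('X - 1%:P).
Proof.
have [->|P0] := eqVneq P 0.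
  by rewrite mulr0 /poly_shift size_poly0 !big_ord0 comp_poly0.
rewrite /poly_shift mulrC size_mulX // big_ord_recl coefMX eqxx scale0r add0r.
rewrite (raddf_sum (comp_poly _)); apply: eq_bigr => i _.
rewrite /= coefMX /= comp_polyZ -comp_polyA; congr (_ *: (_ \Po _)).
by rewrite comp_polyB comp_polyX comp_polyC -addrA -opprD -polyCD nat1r.
Qed.

Definition roots_on_line (a : R) p := p != 0 /\ forall z, root p z -> complex.Re z = a.

Lemma norm_lt_Re (x y : C) : complex.Im x = complex.Im y ->
  (`|x| < `|y|) = (complex.Re x ^+ 2 < complex.Re y ^+ 2).
Proof.
move=> xy; rewrite -(ltr_pXn2r (n := 2)) ?nnegrE //.
by rewrite -!add_Re2_Im2 xy ltcR ltrD2r.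
Qed.

Lemma norm_shift_lt (z r : C) : complex.Re r + 2^-1 < complex.Re z ->
  `|z - 1 - r| < `|z - r|.
Proof.
case: z r => [x y] [a b] /= ax.
by rewrite norm_lt_Re /= ?subr0 // -subr_gt0; nra.
Qed.

Lemma norm_shift_gt (z r : C) : complex.Re z < complex.Re r + 2^-1 ->
  `|z - r| < `|z - 1 - r|.
Proof.
case: z r => [x y] [a b] /= ax.
by rewrite norm_lt_Re /= ?subr0 // -subr_gt0; nra.
Qed.

(* At a root z the values p(z - 1) and p(z) have the same modulus, whereas z - 1
   is closer than z to every root of p if Re z > a + 1/2, and farther away if
   Re z < a + 1/2. *)
Lemma roots_on_line_shift a p (t : C) : roots_on_line a p -> `|t| = 1 -> t != 1 ->
  roots_on_line (a + 2^-1) (p \Po ('X - 1%:P) - t *: p).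
Proof.
move=> [p0 pa] t1 tn1; have lp0 : lead_coef p != 0 by rewrite lead_coef_eq0.
split.
  (* The coefficient in the degree of p is (1 - t) times the leading coefficient of p. *)
  apply: contra_neq lp0 => /(congr1 (fun q : {poly C} => q`_(size p).-1)).
  have sX : size ('X - 1%:P : {poly C}) = 2%N by rewrite size_XsubC.
  have := lead_coef_comp p (q := 'X - 1%:P); rewrite sX => /(_ isT).
  rewrite lead_coefXsubC expr1n mulr1 {1}/lead_coef size_comp_poly2 // => e.
  rewrite coefB coefZ e coef0 -{1}[lead_coef p]mul1r -mulrBl => /eqP.
  by rewrite mulf_eq0 subr_eq0 eq_sym (negPf tn1) => /eqP.
move=> z; rewrite /root hornerD hornerN hornerZ horner_comp !hornerE subr_eq0 => /eqP e.
have [rs prs] := closed_field_poly_normal p.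
have rsP r : r \in rs -> complex.Re r = a.
  move=> rr; apply: pa; rewrite prs rootZ // root_prod_XsubC //.
have pE x : `|p.[x]| = `|lead_coef p| * \prod_(r <- rs) `|x - r|.
  rewrite {1}prs hornerZ normrM horner_prod normr_prod; congr (_ * _).
  by apply: eq_bigr => r _; rewrite !hornerE.
(* The strict comparison of products needs at least one factor; for constant p the equation at z
   would force t = 1. *)
have rs_has : has (fun r => r \in rs) rs.
  case: (rs) prs => [pE0|r rs' _]; last by rewrite /= mem_head.
  move: e; rewrite pE0 big_nil !hornerZ !hornerC !mulr1 => /eqP.
  rewrite -subr_eq0 -{1}[lead_coef p]mul1r -mulrBl mulf_eq0 subr_eq0 eq_sym.
  by rewrite (negPf tn1) (negPf lp0).
have : `|p.[z - 1]| = `|p.[z]| by rewrite e normrM t1 mul1r.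
rewrite !pE => /(mulfI _); rewrite normr_eq0 => /(_ lp0) {}e.
have [zlt|zgt|//] := ltgtP (complex.Re z) (a + 2^-1).
  have : \prod_(r <- rs) `|z - r| < \prod_(r <- rs) `|z - 1 - r|.
    rewrite !big_seq; apply: ltr_prod => // r rr.
    by rewrite normr_ge0 norm_shift_gt // (rsP r).
  by rewrite e ltxx.
have : \prod_(r <- rs) `|z - 1 - r| < \prod_(r <- rs) `|z - r|.
  rewrite !big_seq; apply: ltr_prod => // r rr.
  by rewrite normr_ge0 norm_shift_lt // (rsP r).
by rewrite e ltxx.
Qed.

Lemma roots_on_line_poly_shift a p (s : seq C) : roots_on_line a p ->
  (forall t, t \in s -> `|t| = 1 /\ t != 1) ->
  roots_on_line (a + (size s)%:R / 2) (poly_shift (\prod_(t <- s) ('X - t%:P)) p).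
Proof.
move=> pa; elim: s => [|t s IH] sP.
  rewrite big_nil /poly_shift size_poly1 big_ord1 coef1 scale1r.
  by rewrite subr0 comp_polyXr mul0r addr0.
rewrite big_cons mulrBl poly_shiftB poly_shiftMX mul_polyC poly_shiftZ.
have -> : a + (size (t :: s))%:R / 2 = a + (size s)%:R / 2 + 2^-1 :> R.
  by rewrite /= -natr1; field.
have [t1 tn1] := sP t (mem_head _ _).
by apply: roots_on_line_shift => //; apply: IH => u us; apply: sP; rewrite inE us orbT.
Qed.

End ShiftOperator.

Section BracketRoots.
Variable R : realType.
Local Notation C := R[i].

Lemma size_bracket_Xn n k : (0 < k)%N ->
  size (bracket n.+1 ('X^k : {poly C})) = (k * n).+1.
Proof.
move=> k0; apply/anti_leq/andP; split.
  apply: (leq_trans (size_sum _ _ _)); apply/bigmax_leqP => i _.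
  by rewrite -exprM size_polyXn ltnS leq_mul // -ltnS ltn_ord.
rewrite ltnNge; apply/negP => /(nth_default 0).
by rewrite coef_bracketXn // dvdn_mulr // mulKn // ltnSn => /eqP; rewrite oner_eq0.
Qed.

(** The power t^k is a root of unity of order dividing n + 1, and at t = 1 the value is n + 1. *)
Lemma root_bracket_Xn n k (t : C) : (0 < k)%N -> root (bracket n.+1 'X^k) t ->
  `|t| = 1 /\ t != 1.
Proof.
move=> k0; rewrite /root horner_sum => /eqP t0.
have {}t0 : \sum_(i < n.+1) (t ^+ k) ^+ i = 0.
  by rewrite -[RHS]t0; apply: eq_bigr => i _; rewrite horner_exp hornerXn.
split.
  have : (t ^+ k) ^+ n.+1 = 1 by apply/eqP; rewrite -subr_eq0 subrX1 t0 mulr0.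
  move/(congr1 Num.norm); rewrite -exprM normrX normr1 => /eqP.
  by rewrite pexpr_eq1 ?muln_gt0 ?k0 // => /eqP.
apply: contra_eq_neq t0 => ->; rewrite expr1n.
by under eq_bigr do rewrite expr1n; rewrite sumr_const card_ord pnatr_eq0.
Qed.

Lemma roots_on_line_bracket l n (w : 'I_l.+1 -> nat) a (p : {poly C}) :
  (forall j, 0 < w j)%N -> roots_on_line a p ->
  roots_on_line (a + (n * \sum_j w j)%:R / 2)
    (poly_shift (\prod_j (n.+1%:R^-1 *: bracket n.+1 'X^(w j))) p).
Proof.
move=> w0 pa; set Q := \prod_j _.
have b0 j : bracket n.+1 ('X^(w j) : {poly C}) != 0.
  by rewrite -size_poly_eq0 size_bracket_Xn.
have n0 : n.+1%:R^-1 != 0 :> C by rewrite invr_eq0 pnatr_eq0.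
have sQ : size Q = (n * \sum_j w j).+1.
  rewrite /Q size_prod => [|j _]; last by rewrite scaler_eq0 negb_or n0 b0.
  under eq_bigr do rewrite size_scale // size_bracket_Xn // -addn1.
  rewrite big_split /= sum_nat_const !card_ord muln1 -big_distrl /= mulnC.
  by rewrite -addSn addnK.
have [s Qs] := closed_field_poly_normal Q.
have Q0 : Q != 0 by rewrite -size_poly_eq0 sQ.
have sP t : t \in s -> `|t| = 1 /\ t != 1.
  move=> ts; have : root Q t by rewrite Qs rootZ ?lead_coef_eq0 // root_prod_XsubC.
  rewrite /root horner_prod => /prodf_eq0 [j _].
  rewrite hornerZ mulf_eq0 (negPf n0) /= => tj.
  exact: root_bracket_Xn (w0 j) tj.
(* The number of factors S - t is the degree of Q, and each moves the line by 1/2. *)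
have <- : size s = (n * \sum_j w j)%N.
  by apply: succn_inj; rewrite -sQ {1}Qs size_scale ?lead_coef_eq0 // size_prod_XsubC.
have [r0 rP] := roots_on_line_poly_shift pa sP.
rewrite Qs poly_shiftZ; split; first by rewrite scaler_eq0 lead_coef_eq0 negb_or Q0.
by move=> z; rewrite rootZ ?lead_coef_eq0 //; apply: rP.
Qed.

Lemma roots_on_line_Xn l : roots_on_line (0 : R) ('X^l : {poly C}).
Proof.
split; first by rewrite -size_poly_eq0 size_polyXn.
by move=> z; rewrite /root hornerXn expf_eq0 => /andP [_ /eqP ->].
Qed.

End BracketRoots.

(** * The finite field method *)

Lemma row_free_tuple (F : fieldType) n d (v : d.-tuple 'rV[F]_n) :
  free v = row_free (\matrix_i tnth v i).
Proof.
set B := \matrix_i _; have E (k : 'I_d -> F) : \sum_i k i *: v`_i = (\row_i k i) *m B.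
  rewrite mulmx_sum_row; apply: eq_bigr => i _.
  by rewrite mxE rowK -tnth_nth.
rewrite -kermx_eq0; apply/freeP/rowV0P => [H u /sub_kermxP uB|H k].
  apply/rowP => i; rewrite mxE; apply: (H (fun i => u 0 i)).
  by rewrite E -[RHS]uB; congr (_ *m _); apply/rowP => j; rewrite mxE.
rewrite E => kB i; have := H (\row_i k i); move/(_ (introT sub_kermxP kB)).
by move/rowP/(_ i); rewrite !mxE.
Qed.

(** With solvability expressed by ranks, it can be transferred from R to F_p. *)
Lemma submx_rank (F : fieldType) m n (M : 'M[F]_(m, n)) (b : 'rV[F]_n) :
  (b <= M)%MS = (\rank (col_mx M b) == \rank M).
Proof.
have MS : (M <= col_mx M b)%MS by rewrite -addsmxE addsmxSl.
rewrite eq_sym (mxrank_leqif_sup MS).2 -addsmxE addsmx_sub submx_refl /=.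
by [].
Qed.

Lemma rank_int_diag (F : fieldType) m n (d : seq int) : sorted dvdz d ->
  (forall i, d`_i != 0 -> (d`_i)%:~R != 0 :> F) ->
  \rank (\matrix_(i < m, j < n) (d`_i *+ (i == j :> nat))%:~R : 'M[F]_(m, n)) =
  minn m (minn n (find (pred1 0) d)).
Proof.
move=> ds dF; set r := find _ d.
have dr i : (d`_i != 0) = (i < r)%N.
  apply/idP/idP => [di|ir]; last by have := before_find 0 ir => /= ->.
  rewrite ltnNge; apply: contra di => ri.
  have [id|id] := ltnP i (size d); last by rewrite nth_default.
  have hr : has (pred1 0) d by rewrite has_find (leq_ltn_trans ri).
  have /eqP := nth_find 0 hr; rewrite -/r => r0.
  have : (d`_r %| d`_i)%Z.
    have tr : transitive dvdz by move=> y x z; apply: dvdz_trans.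
    have rf : reflexive dvdz by move=> x; apply: dvdzz.
    by apply: (sorted_leq_nth tr rf 0 ds); rewrite ?inE ?(leq_ltn_trans ri).
  by rewrite r0 dvd0z.
(* By divisibility the zeros come last in d. Replacing them by 1 gives an invertible diagonal
   factor, and the other factor is a partial identity of rank r. *)
pose e := \row_(i < m) (if (i < r)%N then (d`_i)%:~R else 1 : F).
have eU : diag_mx e \in unitmx.
  rewrite unitmxE det_diag unitfE; apply/prodf_neq0 => i _; rewrite mxE.
  by case: ifP => ir; rewrite ?oner_eq0 // dF // dr.
have -> : \matrix_(i < m, j < n) (d`_i *+ (i == j :> nat))%:~R = diag_mx e *m pid_mx r.
  apply/matrixP => i j; rewrite mul_diag_mx !mxE.
  have [ij|ij] := eqVneq (i : nat) j; last by rewrite mulr0.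
  case: ltnP => ir; rewrite ?mulr1 // mulr0.
  by move: ir; rewrite leqNgt -dr negbK => /eqP ->; rewrite mul0rn.
rewrite eqmxMfull ?row_full_unit //.
rewrite -pid_mx_minh -pid_mx_minv rank_pid_mx ?geq_minl //.
by rewrite geq_min geq_minl orbT.
Qed.

(** In the Smith normal form the unimodular factors stay invertible over every field, and the
    nonzero invariant factors stay nonzero modulo any prime exceeding the sum of their absolute
    values. *)
Lemma rank_int_prime (R : realType) m n (A : 'M[int]_(m, n)) :
  exists N, forall p, prime p -> (N < p)%N ->
  \rank (map_mx (intr : int -> 'F_p) A) = \rank (map_mx (intr : int -> R) A).
Proof.
have [L LU [U UU [d ds AE]]] := int_Smith_normal_form A.
have rk (F : fieldType) : (forall i, d`_i != 0 -> (d`_i)%:~R != 0 :> F) ->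
    \rank (map_mx (intr : int -> F) A) = minn m (minn n (find (pred1 0) d)).
  move=> dF; rewrite -(rank_int_diag _ _ ds dF) AE !map_mxM.
  have unitF k (B : 'M[int]_k) : B \in unitmx -> map_mx (intr : int -> F) B \in unitmx.
    by rewrite !unitmxE det_map_mx; apply: rmorph_unit.
  rewrite mxrankMfree ?row_free_unit ?unitF // eqmxMfull ?row_full_unit ?unitF //.
  by congr mxrank; apply/matrixP => i j; rewrite !mxE.
exists (\sum_(x <- d) `|x|)%N => p pr Np.
rewrite !rk // => i di; rewrite ?intr_eq0 //.
have iN : (absz (nth 0%R d i) <= \sum_(x <- d) absz x)%N.
  have [id|id] := ltnP i (size d); last by rewrite nth_default.
  by rewrite (big_nth 0) big_mkord (bigD1 (Ordinal id)) //= leq_addr.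
have [z zE] : exists2 z : nat, (0 < z < p)%N &
    (d`_i)%:~R = z%:R :> 'F_p \/ (d`_i)%:~R = - z%:R :> 'F_p.
  exists (absz (d`_i)); first by rewrite absz_gt0 di (leq_ltn_trans iN).
  have [i0|i0] := leP 0 (d`_i); [left|right].
    by rewrite -[in LHS](gez0_abs i0) pmulrn.
  by rewrite -[in LHS](opprK (d`_i)) -(ltz0_abs i0) intrN pmulrn.
have z0 : z%:R != 0 :> 'F_p.
  rewrite -(dvdn_pcharf (pchar_Fp pr)) gtnNdvd //; by case/andP: zE.
by case=> ->; rewrite ?oppr_eq0.
Qed.

Lemma card_solutions_mulmx p l k (M : 'M['F_p]_(l, k)) (b : 'rV_k) : prime p ->
  #|[set x : 'rV_l | x *m M == b]| =
  if (b <= M)%MS then (p ^ (l - \rank M))%N else 0%N.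
Proof.
move=> pr; case: ifPn => [/submxP [x0 x0b]|bM]; last first.
  apply/eqP; rewrite cards_eq0; apply/eqP/setP => x; rewrite !finset.in_set.
  by apply: contraNF bM => /eqP <-; apply: submxMl.
rewrite -mxrank_ker -[X in (X ^ _)%N](card_Fp pr) -card_rowg.
rewrite -(card_imset _ (addIr (- x0))); apply: eq_card => y.
rewrite /rowg finset.in_set; apply/imsetP/sub_kermxP => [[x]|yM].
  by rewrite finset.in_set => /eqP xb ->; rewrite mulmxBl xb x0b subrr.
exists (y + x0); last by rewrite addrK.
by rewrite finset.in_set mulmxDl yM add0r x0b.
Qed.

Lemma affine_dim_solutions (R : realType) l k (N : 'M[R]_(l, k)) (b : 'rV_k)
    (S : set 'rV[R]_l) : (forall x, S x <-> x *m N = b) -> (b <= N)%MS ->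
  affine_dim S = (l - \rank N)%N.
Proof.
move=> SE /submxP [x0 x0b]; rewrite -mxrank_ker.
have kl : (\rank (kermx N) < l.+1)%N by rewrite ltnS rank_leq_col.
apply/anti_leq/andP; split.
  apply/bigmax_leqP => d /asboolP [x [v [Sx vf vS]]].
  move: vf; rewrite row_free_tuple => /eqP <-.
  apply/mxrankS/sub_kermxP/row_matrixP => i; rewrite row_mul rowK row0.
  have /SE := vS i; have /SE := Sx.
  by rewrite mulmxDl => -> /eqP; rewrite -subr_eq0 addrAC subrr add0r => /eqP.
apply: (@leq_bigmax_cond _ _ (fun d : 'I_l.+1 => d : nat) (Ordinal kl)).
apply/asboolP; exists x0, [tuple row i (row_base (kermx N)) | i < \rank (kermx N)].
split; first by apply/SE.
  rewrite row_free_tuple (_ : \matrix_i _ = row_base (kermx N)) ?row_base_free //.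
  by apply/row_matrixP => i; rewrite rowK tnth_mktuple.
move=> i; apply/SE; rewrite tnth_mktuple mulmxDl -x0b -row_mul.
rewrite (_ : row_base _ *m N = 0) ?row0 ?addr0 //.
by apply/sub_kermxP; rewrite eq_row_base.
Qed.

(** Solvability and dimension depend only on the ranks of M and of its augmentation by b, which
    agree over R and over F_p for large p. The matrix T changes to coordinates with integral
    equations. *)
Lemma card_solutions_prime (R : realType) l k (M : 'M[int]_(l, k)) (b : 'rV[int]_k)
    (T : 'M[R]_l) (S : set 'rV[R]_l) : T \in unitmx ->
  (forall x, S x <-> x *m (T *m map_mx intr M) = map_mx intr b) ->
  exists N, forall p, prime p -> (N < p)%N ->
  #|[set x : 'rV['F_p]_l | x *m map_mx intr M == map_mx intr b]| =
  if `[< S !=set0 >]%classic then (p ^ affine_dim S)%N else 0%N.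
Proof.
move=> TU SE.
have [N1 H1] := rank_int_prime R M; have [N2 H2] := rank_int_prime R (col_mx M b).
exists (maxn N1 N2) => p pr; rewrite gtn_max => /andP [pN1 pN2].
have TM : (T *m map_mx intr M :=: map_mx (intr : int -> R) M)%MS.
  by apply: eqmxMfull; rewrite row_full_unit.
have -> : `[< S !=set0 >]%classic = (map_mx intr b <= T *m map_mx (intr : int -> R) M)%MS.
  apply/asboolP/submxP => [[x /SE <-]|[x xb]]; first by exists x.
  by exists x; apply/SE.
rewrite card_solutions_mulmx // TM.
rewrite !submx_rank -!map_col_mx H1 // H2 //; case: ifPn => // Hb.
rewrite (affine_dim_solutions SE) ?TM //.
by rewrite submx_rank -map_col_mx.
Qed.

(** The indicator of the complement is the product of the factors 1 - [E i x], which is expanded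
    over subsets. *)
Lemma inclusion_exclusion (F : comNzRingType) (X I : finType) (E : I -> pred X) :
  #|[set x | [forall i, ~~ E i x]]|%:R =
  \sum_(B : {set I}) (-1) ^+ #|B| * #|[set x | [forall (i | i \in B), E i x]]|%:R :> F.
Proof.
have cardE (P : pred X) : #|[set x | P x]|%:R = \sum_x (P x)%:R :> F.
  rewrite -sum1_card natr_sum big_mkcond; apply: eq_bigr => x _.
  by rewrite finset.in_set; case: (P x).
have forallE (P Q : pred I) :
    [forall (i | P i), Q i]%:R = \prod_(i | P i) (Q i)%:R :> F.
  have [i /andP [Pi /negPf Qi]|PQ] := pickP (fun i => P i && ~~ Q i).
    rewrite (bigD1 i) //= Qi mul0r; case: forallP => // /(_ i).
    by rewrite Pi Qi.
  rewrite big1 => [|i Pi]; last by have := PQ i; rewrite Pi => /negbFE ->.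
  case: forallP => // -[] i; apply/implyP => Pi.
  by have := PQ i; rewrite Pi => /negbFE.
transitivity (\sum_x \prod_i (- (E i x)%:R + 1) : F).
  rewrite cardE; apply: eq_bigr => x _.
  rewrite (forallE predT (fun i => ~~ E i x)); apply: eq_bigr => i _.
  by case: (E i x); rewrite ?addNr ?oppr0 ?add0r.
under eq_bigr do rewrite bigA_distr.
rewrite exchange_big /=; apply: eq_bigr => B _; rewrite cardE mulr_sumr.
apply: eq_bigr => x _; rewrite (forallE (mem B) (fun i => E i x)) -big_mkcond /= prodrN.
by [].
Qed.

Lemma big_fpowerset (K : choiceType) (A : {fset K}) (W : nmodType)
    (P : pred {fset K}) (F : {fset K} -> W) :
  \sum_(B <- fpowerset A | P B) F B =
  \sum_(Y : {set A} | P [fsetval y in Y]%fset) F [fsetval y in Y]%fset.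
Proof.
rewrite -(big_map (fun Y : {set A} => [fsetval y in Y]%fset) P F).
apply: perm_big; apply: uniq_perm.
- exact: fset_uniq.
- rewrite map_inj_uniq ?index_enum_uniq // => Y Z YZ; apply/setP => y.
  have := congr1 (fun B : {fset K} => fsval y \in B) YZ.
  by rewrite /= !val_in_fset.
move=> B; rewrite fpowersetE; apply/idP/mapP => [BA|[Y _ ->]].
  exists (fsub A B); first by rewrite mem_index_enum.
  apply/fsetP => x; apply/idP/in_fset_valP => [xB|[xA]].
    by exists (fsubsetP BA _ xB); rewrite in_fsub.
  by rewrite in_fsub.
by apply/fsubsetP => x /in_fset_valP [].
Qed.

Lemma eqr_nat_Fp p a b : prime p -> (a%:R == b%:R :> 'F_p) = (a == b %[mod p])%N.
Proof.
move=> pr; wlog ba : a b / (b <= a)%N => [H|].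
  have [/H //|/ltnW /H H'] := leqP b a.
  by rewrite eq_sym H' eq_sym.
by rewrite -subr_eq0 -natrB // -(dvdn_pcharf (pchar_Fp pr)) eqn_mod_dvd.
Qed.

Section FiniteField.
Variables (R : realType) (l : nat) (Phi : {fset 'rV[R]_l}) (c : 'I_l -> nat).
Local Notation V := 'rV[R]_l.
Hypothesis rsPhi : root_system Phi.
Variable alpha : 'I_l -> V.
Hypothesis ab : labelled_base Phi c alpha.
Variable n : nat.

(** The arrangement is a set of hyperplanes, whereas avoidance ranges over pairs of a root and a
    level. Equal hyperplanes have proportional normals, and for two positive roots the factor is
    1. *)
Lemma hyperplane_inj (a b : V) (k j : nat) : a \in pos_roots Phi alpha ->
  b \in pos_roots Phi alpha -> (0 < k)%N -> (0 < j)%N ->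
  hyperplane a k = hyperplane b j -> a = b /\ k = j.
Proof.
rewrite !(pos_rootsE rsPhi ab) => /andP [aP a0] /andP [bP b0] k0 j0 e.
have aa := dot_gt0 (root_neq0 rsPhi aP); have aa0 := lt0r_neq0 aa.
pose x := (k%:R / dot a a) *: a; pose t := dot a b / dot a a.
have bx : dot b x = j%:R.
  have : hyperplane a k x by rewrite /hyperplane /= dotZr divfK.
  by rewrite e.
(* The part of b orthogonal to a is a direction of the common hyperplane, hence orthogonal to b and
   so to itself. *)
have bta : b - t *: a = 0.
  apply/eqP; apply: contraT => y0; have := dot_gt0 y0; rewrite dotBl dotZl.
  have ay : dot a (b - t *: a) = 0 by rewrite dotBr dotZr divfK // subrr.
  rewrite ay mulr0 subr0.
  have : dot b (x + (b - t *: a)) = j%:R.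
    suff : hyperplane b j (x + (b - t *: a)) by [].
    by rewrite -e /hyperplane /= dotDr ay addr0 dotZr divfK.
  rewrite (dotDr b x) bx => /(canRL (addKr _)).
  by rewrite addNr => ->; rewrite ltxx.
have {bta} bta : b = t *: a by apply/eqP; rewrite -subr_eq0 bta.
have [_ _ _ _ /(_ a t aP)] := rsPhi; rewrite -bta => /(_ bP) [t1|tN1]; last first.
  by move: b0; rewrite bta tN1 scaleN1r dotNl oppr_gt0 ltNge ltW.
have {}bta : a = b by rewrite bta t1 scale1r.
split => //; apply/eqP; rewrite -(eqr_nat R) -bx -bta.
by rewrite dotZr divfK.
Qed.

Local Notation A := (linial Phi alpha n).

Let hyperplane_data (H : A) (d : V * nat * ('I_l -> nat)) :=
  [/\ d.1.1 \in pos_roots Phi alpha, (1 <= d.1.2 <= n)%N,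
      fsval H = hyperplane d.1.1 d.1.2
    & forall x, dot d.1.1 x = \sum_i (d.2 i)%:R * dot (alpha i) x].

Let hyperplane_data_exists H : exists d, hyperplane_data H d.
Proof.
have /imfset2P [a /= aP [k /= kn HE]] := fsvalP H.
move: (aP); rewrite !inE /= => /andP [_ /asboolP [m am]].
exists (a, k, m); split => //; first by move: kn; rewrite mem_iota add1n ltnS.
by move=> x; rewrite am dot_nat_comb.
Qed.

Lemma char_poly_arr_prime : exists N, forall p, prime p -> (N < p)%N ->
  (char_poly_arr A).[p%:R] = #|avoiding Phi alpha p n|%:R.
Proof.
have [d dP] := choice hyperplane_data_exists.
pose a H := (d H).1.1; pose k H := (d H).1.2; pose m H := (d H).2.
(* One column per hyperplane of the whole arrangement, zero outside B, gives all the systems the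
   same shape. *)
pose M (B : {set A}) : 'M[int]_(l, #|{: A}|) :=
  \matrix_(i, h) (if enum_val h \in B then (m (enum_val h) i)%:Z else 0).
pose v (B : {set A}) : 'rV[int]_#|{: A}| :=
  \row_h (if enum_val h \in B then (k (enum_val h))%:Z else 0).
pose S (B : {set A}) := inter_of [fsetval y in B]%fset.
pose T := (\matrix_i alpha i)^T : 'M[R]_l.
have TU : T \in unitmx by rewrite unitmx_tr (base_unitmx ab).
have SE B x : S B x <-> x *m (T *m map_mx intr (M B)) = map_mx intr (v B).
  have xT i : (x *m T) 0 i = dot (alpha i) x.
    by rewrite mxE; apply: eq_bigr => j _; rewrite !mxE mulrC.
  have mem_S : S B x <-> forall H : A, H \in B -> dot (a H) x = (k H)%:R.
    split=> [SBx H HB|H X /= /in_fset_valP [XA XB]].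
      have [_ _ HE _] := dP H; have := SBx (fsval H).
      by rewrite /= val_in_fset HE; apply.
    have [_ _ /= HE _] := dP [` XA]%fset.
    by rewrite HE; apply: H.
  rewrite mem_S mulmxA; split=> [H|e H HB].
    apply/rowP => h; rewrite !mxE; case: ifP => hB; last first.
      by rewrite big1 // => i _; rewrite !mxE hB mulr0.
    have [_ _ _ E] := dP (enum_val h).
    rewrite -[RHS](H _ hB) E; apply: eq_bigr => i _.
    by rewrite xT !mxE hB mulrC -pmulrn.
  have [_ _ _ E] := dP H; rewrite E.
  have := congr1 (fun w : 'rV_ _ => w 0 (enum_rank H)) e.
  rewrite !mxE enum_rankK HB -pmulrn => <-; apply: eq_bigr => i _.
  by rewrite xT !mxE enum_rankK HB mulrC -pmulrn.
have [N HN] := choice (fun B => card_solutions_prime TU (SE B)).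
exists (\sum_B N B)%N => p pr Np.
pose E H (g : {ffun 'I_l -> 'I_p}) := (\sum_i m H i * g i == k H %[mod p])%N.
have avoidE : avoiding Phi alpha p n = [set g | [forall H, ~~ E H g]].
  have [aP _ _ _] := ab.
  have dotX H g : dot (a H) (residue_point alpha g) = (\sum_i m H i * g i)%:R.
    have [_ _ _ ->] := dP H; rewrite natr_sum; apply: eq_bigr => i _.
    by rewrite (dual_combE ab) natrM.
  apply/setP => g; rewrite !finset.in_set; apply/asboolP/forallP.
    move=> av H; have [aH kH _ _] := dP H.
    apply/negP => EH; apply: (av (a H) (k H) aH kH).
    have : (p %| (\sum_i m H i * g i)%:Z - (k H)%:Z)%Z.
      by rewrite -eqz_mod_dvd !modz_nat; apply/eqP; congr Posz; apply/eqP.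
    case/dvdzP => z zE; exists z.
    by rewrite dotX !pmulrn -intrB -intrM; congr _%:~R.
  move=> H b j bP jn [z zE].
  have HA : hyperplane b j \in A.
    by apply/imfset2P; exists b => //; exists j => //=; rewrite mem_iota add1n ltnS.
  have [X XE] : exists X : A, fsval X = hyperplane b j by exists [` HA]%fset.
  have [aX /andP [k0 kn] HE _] := dP X; rewrite XE in HE.
  have [j0 _] := andP jn.
  have [ba jk] := hyperplane_inj bP aX j0 k0 HE.
  have := H X; apply/negP; rewrite negbK /E.
  move: zE; rewrite {1}ba dotX jk -/(k _) !pmulrn -intrB -intrM => /eqP.
  rewrite eqr_int => /eqP zE.
  suff : (\sum_i m X i * g i = k X %[mod p])%Z by rewrite !modz_nat => -[->].
  by apply/eqP; rewrite eqz_mod_dvd zE dvdz_mull.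
rewrite avoidE inclusion_exclusion /char_poly_arr big_fpowerset horner_sum big_mkcond.
apply: eq_bigr => B _.
have pB : (N B < p)%N by apply: leq_ltn_trans Np; rewrite (bigD1 B) //= leq_addr.
have -> : #|[set g | [forall (H | H \in B), E H g]]| =
    #|[set x : 'rV['F_p]_l | x *m map_mx intr (M B) == map_mx intr (v B)]|.
  pose phi (g : {ffun 'I_l -> 'I_p}) : 'rV['F_p]_l := \row_i (g i)%:R.
  have phi_inj : injective phi.
    move=> g g' /rowP gg; apply/ffunP => i; apply: val_inj.
    have := gg i; rewrite !mxE => /eqP; rewrite eqr_nat_Fp // !modn_small //.
    by move/eqP.
  have phi_bij : bijective phi.
    by apply: inj_card_bij => //; rewrite card_mx card_Fp // card_ffun !card_ord mul1n.
  rewrite -(on_card_preimset (onW_bij _ phi_bij)); apply: eq_card => g.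
  rewrite !finset.in_set.
  have EH H : E H g = ((\sum_i m H i * g i)%:R == (k H)%:R :> 'F_p).
    by rewrite eqr_nat_Fp.
  have xM h : (phi g *m map_mx intr (M B)) 0 h = map_mx intr (v B) 0 h <->
      (enum_val h \in B -> E (enum_val h) g).
    rewrite EH !mxE; case: ifP => hB; last first.
      by split=> // _; rewrite big1 // => i _; rewrite !mxE hB mulr0.
    have -> : \sum_i phi g 0 i * map_mx intr (M B) i h =
        (\sum_i m (enum_val h) i * g i)%:R.
      by rewrite natr_sum; apply: eq_bigr => i _; rewrite !mxE hB natrM mulrC -pmulrn.
    by rewrite -pmulrn; split=> [-> //|/(_ isT) /eqP].
  apply/forallP/eqP => [H|e H].
    by apply/rowP => h; apply/xM => hB; have /implyP := H (enum_val h); apply.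
  apply/implyP => HB; have /xM := congr1 (fun w : 'rV_ _ => w 0 (enum_rank H)) e.
  by rewrite enum_rankK; apply.
rewrite (HN B p pr pB) -/(S B); case: ifP => _; last by rewrite mulr0.
rewrite hornerZ hornerXn natrX; congr ((-1) ^+ _ * _).
by rewrite card_imfset //= ?cardE; last exact: val_inj.
Qed.

End FiniteField.

(** * The characteristic quasi-polynomial *)

Lemma ncard_imset (I : finType) (T : choiceType) (f : I -> T) (P : {set I})
    (A : set T) : {in P &, injective f} ->
  (forall x, A x <-> exists2 i, i \in P & x = f i) -> ncard A = #|P|.
Proof.
move=> fI AE; rewrite /ncard.
have -> : A = [set` [fset f i | i in P]%fset]%classic.
  apply/classical_sets.seteqP; split=> x.
    by move/AE => [i iP ->]; apply/imfsetP; exists i.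
  by move/imfsetP => [i /= iP ->]; apply/AE; exists i.
by rewrite set_fsetK card_in_imfset //= cardE.
Qed.

(** The bijection subtracts g; its inverse stays within the bound q because all marks are at least
    1. *)
Lemma card_shifted_solutions l (c g : 'I_l -> nat) g0 q :
  (forall i, 0 < c i)%N -> (\sum_i c i * g i + g0 <= q)%N ->
  #|[set y : {ffun 'I_l -> 'I_q.+1} |
      [forall i, g i <= y i]%N && (\sum_i c i * y i + g0 <= q)%N]| =
  #|[set y : {ffun 'I_l -> 'I_q.+1} |
      (\sum_i c i * y i <= q - (\sum_i c i * g i + g0))%N]|.
Proof.
move=> c0 gq; pose f (y : {ffun 'I_l -> 'I_q.+1}) : {ffun 'I_l -> 'I_q.+1} :=
  [ffun i => inord (y i - g i)].
have fE y i : f y i = (y i - g i)%N :> nat.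
  by rewrite ffunE inordK // (leq_ltn_trans (leq_subr _ _)).
rewrite -[LHS](@card_in_imset _ _ f) => [|y y']; last first.
  rewrite !finset.in_set => /andP [/forallP gy _] /andP [/forallP gy' _] ff.
  apply/ffunP => i; apply: val_inj; rewrite /= -(subnK (gy i)) -(subnK (gy' i)).
  by rewrite -!fE ff.
apply: eq_card => z; apply/imsetP/idP => [[y]|].
  rewrite !finset.in_set => /andP [/forallP gy yq] ->.
  have : (\sum_i c i * f y i + \sum_i c i * g i = \sum_i c i * y i)%N.
    rewrite -big_split; apply: eq_bigr => i _; rewrite /= fE -mulnDr subnK //.
  move: yq gq; move: (\sum_i c i * f y i)%N (\sum_i c i * g i)%N.
  by move: (\sum_i c i * y i)%N => D A B; lia.
rewrite finset.in_set => zq.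
have zgq i : (z i + g i < q.+1)%N.
  rewrite ltnS; apply: (@leq_trans (c i * (z i + g i))); first by rewrite leq_pmull.
  apply: (@leq_trans (\sum_i c i * (z i + g i))).
    by rewrite (bigD1 i) //= leq_addr.
  under eq_bigr do rewrite mulnDr; rewrite big_split /=.
  move: zq gq; move: (\sum_i c i * z i)%N (\sum_i c i * g i)%N => A B.
  by lia.
exists [ffun i => Ordinal (zgq i)]; last first.
  by apply/ffunP => i; apply: val_inj; rewrite /= fE ffunE /= addnK.
rewrite finset.in_set; apply/andP; split.
  by apply/forallP => i; rewrite ffunE /= leq_addl.
under eq_bigr do rewrite ffunE /= mulnDr; rewrite big_split /=.
move: zq gq; move: (\sum_i c i * z i)%N (\sum_i c i * g i)%N => A B.
by lia.
Qed.

Section Bridge.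
Variables (R : realType) (l : nat) (Phi : {fset 'rV[R]_l}) (c : 'I_l -> nat).
Local Notation V := 'rV[R]_l.
Local Notation C := R[i].
Hypothesis rsPhi : root_system Phi.
Variable alpha : 'I_l -> V.
Hypothesis ab : labelled_base Phi c alpha.

Lemma ext_coef_gt0 j : (0 < ext_coef c j)%N.
Proof.
rewrite /ext_coef; case: unliftP => // i _; exact: (marks_gt0 rsPhi i ab).
Qed.

Lemma ncard_linial_complement n q : (0 < q)%N ->
  ncard (linial_complement Phi alpha n q) = #|avoiding Phi alpha q n|.
Proof.
move=> q0.
have coset_eq x x' : coset_mod alpha q x = coset_mod alpha q x' <->
    congruent Phi q x x'.
  split=> [e|[y yP ->]].
    have : coset_mod alpha q x x.
      by exists 0; rewrite ?scaler0 ?addr0 // => i; rewrite dot0r rpred0.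
    by rewrite e => -[z /(coweightP rsPhi _ ab) zP <-]; exists z.
  apply/classical_sets.seteqP; split=> _ [z /(coweightP rsPhi _ ab) zP <-].
    exists (y + z); last by rewrite scalerDr addrA.
    by apply/(coweightP rsPhi _ ab)/coweightD.
  exists (z - y); last by rewrite scalerBr addrACA subrr addr0.
  by apply/(coweightP rsPhi _ ab)/coweightB.
apply: (@ncard_imset _ _ (fun g => coset_mod alpha q (residue_point alpha g))).
  by move=> g g' _ _ /= e; apply: (residue_point_inj rsPhi ab q0); apply/coset_eq.
move=> X; split=> [[x [/(coweightP rsPhi _ ab) xP xav] <-]|[g gav ->]].
  have [g xg] := residue_point_exists rsPhi ab q0 xP.
  exists g; last exact/coset_eq.
  rewrite finset.in_set; apply/asboolP.
  exact: (avoids_congruent rsPhi ab (congruent_sym xg)).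
exists (residue_point alpha g) => //; split.
  by apply/(coweightP rsPhi _ ab); apply: (coweight_residue_point rsPhi ab).
by move: gav; rewrite finset.in_set => /asboolP.
Qed.

Lemma ncard_alcove_points q :
  (ncard (alcove_points alpha c q))%:R = solutions C (ext_coef c) q.
Proof.
rewrite -(card_bounded_solutions C (fun i => marks_gt0 rsPhi i ab) (ltnSn q)).
congr _%:R; apply: (@ncard_imset _ _ (@label_point R l q alpha)).
  move=> y y' _ _ e; apply/ffunP => i; apply: val_inj; apply/eqP.
  rewrite -(eqr_nat R) /=; apply/eqP.
  by have := congr1 (dot (alpha i)) e; rewrite !(dual_combE ab).
have S y : dot (nat_comb alpha c) (label_point alpha y) = (\sum_i c i * y i)%N%:R.
  rewrite dot_nat_comb natr_sum; apply: eq_bigr => i _.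
  by rewrite (dual_combE ab) natrM.
move=> x; split=> [[/(coweightP rsPhi _ ab) xP x0 xq]|[y yq ->]].
  have [y xy] := label_point_exists rsPhi ab xP x0 xq.
  by exists y => //; rewrite finset.in_set -(ler_nat R) -S -xy.
split.
- by apply/(coweightP rsPhi _ ab); apply: (coweight_label_point rsPhi ab).
- by move=> i; rewrite (dual_combE ab) ler0n.
by move: yq; rewrite finset.in_set S ler_nat.
Qed.

(** This is the number a_b: the total gap at the walls, weighted by the marks, for a gap of one
    unit. *)
Definition ascents (b : 'I_l -> V) : nat :=
  (\sum_i c i * ascent alpha (b i) + ascent alpha (- nat_comb b c))%N.

Lemma card_gap_labels_solutions n q b : (n.+1 * ascents b <= q)%N ->
  #|gap_labels c alpha q b n|%:R =
  solutions C (ext_coef c) (q - n.+1 * ascents b)%N.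
Proof.
have E : (\sum_i c i * (n.+1 * ascent alpha (b i)) +
    n.+1 * ascent alpha (- nat_comb b c) = n.+1 * ascents b)%N.
  rewrite /ascents mulnDr big_distrr; congr (_ + _)%N.
  by apply: eq_bigr => i _; rewrite mulnCA.
move=> bq; have c0 i := marks_gt0 rsPhi i ab.
rewrite /gap_labels card_shifted_solutions ?E //.
by rewrite (card_bounded_solutions C c0) // ltnS leq_subr.
Qed.

Lemma ehrhartE : quasi_polynomial (ehrhart alpha c) /\
  forall q : nat, ehrhart alpha c q%:Z = solutions C (ext_coef c) q.
Proof.
have [f fq fE] := solutions_quasi_polynomial R ext_coef_gt0.
suff -> : ehrhart alpha c = f by [].
apply: xget_unique; first by split=> // q; rewrite fE ncard_alcove_points.
move=> g [gq gE]; apply: (quasi_polynomial_unique (q0 := 0) gq fq) => q _.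
by rewrite gE fE ncard_alcove_points.
Qed.

Let L := ehrhart alpha c.
Let is_base (b : {ffun 'I_l -> Phi}) := `[< labelled_base Phi c (fun i => fsval (b i)) >].
Let asc (b : {ffun 'I_l -> Phi}) := ascents (fun i => fsval (b i)).
Let N : C := (base_number Phi c alpha)%:R.

(** For q beyond all (n + 1) a_b, subtracting the gaps turns each term of [avoiding_count] into a
    value of the Ehrhart quasi-polynomial. *)
Lemma avoiding_ehrhart n : exists q0, forall q : nat, (q0 < q)%N ->
  \sum_(b | is_base b) L (q%:Z - n.+1%:Z * (asc b)%:Z) =
  N * (#|avoiding Phi alpha q n|)%:R.
Proof.
have [_ LE] := ehrhartE.
exists (\sum_b n.+1 * asc b)%N => q bq.
rewrite -natrM avoiding_count //; last exact: leq_ltn_trans bq.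
rewrite natr_sum; apply: eq_bigr => b _.
have bq' : (n.+1 * asc b <= q)%N.
  by apply: leq_trans (ltnW bq); rewrite (bigD1 b) //= leq_addr.
by rewrite card_gap_labels_solutions // -LE -subzn.
Qed.

Lemma char_quasiE n : coprime n.+1 (minimal_period L) ->
  (exists q0, forall q, (q0 < q)%N ->
     char_quasi Phi alpha n q%:Z = (#|avoiding Phi alpha q n|)%:R) /\
  forall t, char_quasi Phi alpha n t = (n.+1%:R ^- l.+1 *
    \sum_(r : {ffun 'I_l.+1 -> 'I_n.+1})
      (t - (\sum_j ext_coef c j * r j)%N%:Z)%:~R ^+ l).
Proof.
move=> cop; have [Lq LE] := ehrhartE; have Lrho := minimal_periodP Lq.
have [rho0 _] := Lrho.
have N0 : N != 0 by rewrite pnatr_eq0 -lt0n base_number_gt0.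
pose f (t : int) : C := N^-1 * \sum_(b | is_base b) L (t - n.+1%:Z * (asc b)%:Z).
have fq : quasi_polynomial f.
  exists (minimal_period L); apply: has_periodZ; apply: has_period_sum => // b _.
  exact: has_period_shift.
have [q1 fE] : exists q1, forall q, (q1 < q)%N ->
    f q%:Z = (#|avoiding Phi alpha q n|)%:R.
  have [q1 H] := avoiding_ehrhart n; exists q1 => q qq1.
  by rewrite /f H // mulKf.
have charE : char_quasi Phi alpha n = f.
  apply: xget_unique.
    split=> //; exists q1 => q qq1; rewrite fE // ncard_linial_complement //.
    exact: leq_ltn_trans qq1.
  move=> g [gq [q2 gE]].
  apply: (quasi_polynomial_unique (q0 := maxn q1 q2) gq fq) => q.
  rewrite gtn_max => /andP [qq1 qq2]; rewrite gE // fE // ncard_linial_complement //.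
  exact: leq_ltn_trans qq1.
rewrite charE; split; first by exists q1.
(* For n = 0 no level is forbidden, all q^l classes are counted, and Worpitzky's identity
   results. *)
have [q2 worpitzky] := avoiding_ehrhart 0.
pose wr (r : {ffun 'I_l.+1 -> 'I_n.+1}) := (\sum_j ext_coef c j * r j)%N.
pose q0 := maxn q2 (\sum_r wr r)%N.
have W : forall q : nat, (q0 < q)%N ->
    \sum_(b | is_base b) L (q%:Z - (asc b)%:Z) = N * q%:R ^+ l.
  move=> q; rewrite gtn_max => /andP [qq2 _].
  have := worpitzky q qq2; under eq_bigr do rewrite mul1r; move=> ->.
  congr (_ * _); rewrite -natrX; congr _%:R.
  rewrite (_ : avoiding _ _ _ _ = finset.setTfor _) ?cardsT ?card_ffun ?card_ord //.
  apply/setP => g; rewrite !finset.in_set; apply/asboolP => a [|k] _ //.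
have D : forall q : nat, (q0 < q)%N ->
    L q%:Z = \sum_r (if (n.+1 %| q%:Z - (wr r)%:Z)%Z
                     then L ((q%:Z - (wr r)%:Z) %/ n.+1)%Z else 0).
  move=> q; rewrite gtn_max => /andP [_ qr].
  rewrite /L LE (solutions_dilation C ext_coef_gt0 q (ltn0Sn n)); apply: eq_bigr => r _.
  have rq : (wr r <= q)%N.
    by apply: leq_trans (ltnW qr); rewrite (bigD1 r) //= leq_addr.
  by rewrite /= -/(wr r) rq subzn // dvdzE /= divz_nat LE.
move=> t; rewrite /f (dilated_worpitzky (ltn0Sn n) cop N0 Lrho W D).
by rewrite mulKf.
Qed.

End Bridge.

Lemma poly_eq_primes (R : realType) (P Q : {poly R[i]}) N :
  (forall p, prime p -> (N < p)%N -> P.[p%:R] = Q.[p%:R]) -> P = Q.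
Proof.
move=> PQ; pose next k := s2val (prime_above k).
pose u k := iter k.+1 next N.
have u_lt k : (u k < u k.+1)%N.
  by rewrite /u [iter k.+2 _ _]iterS /next; case: prime_above.
have Nu k : (N < u k)%N.
  elim: k => [|k IH]; last exact: ltn_trans IH (u_lt k).
  by rewrite /u /= /next; case: prime_above.
have u_prime k : prime (u k) by rewrite /u iterS /next; case: prime_above.
have u_inj : injective u.
  have u_homo := homo_ltn ltn_trans u_lt.
  by move=> j k e; case: (ltngtP j k) => // /u_homo; rewrite e ltnn.
apply/eqP; rewrite -subr_eq0; apply/eqP.
apply: (@poly_inf_roots _ _ (fun k => (u k)%:R)) => [j k /eqP|k].
  by rewrite eqr_nat => /eqP /u_inj.
by rewrite /root hornerD hornerN PQ // subrr.
Qed.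

Theorem theorem3p6 (R : realType) (l : nat) (Phi : {fset 'rV[R]_l})
    (alpha : 'I_l -> 'rV[R]_l) (c : 'I_l -> nat) (n : nat)
    (hPhi : irreducible_root_system Phi)
    (halpha : simple_system Phi alpha)
    (hc : highest_root Phi alpha (nat_comb alpha c))
    (hn : coprime n.+1 (minimal_period (ehrhart alpha c))) :
  [/\ forall t : int,
        char_quasi Phi alpha n t =
        shift_poly
          (\prod_(j < l.+1)
             ((n.+1)%:R^-1 *: bracket n.+1 ('X^(ext_coef c j) : {poly R[i]})))
          (fun s : int => s%:~R ^+ l) t,
      exists P : {poly R[i]},
        forall t : int, char_quasi Phi alpha n t = P.[t%:~R]
    & forall z : R[i], root (char_poly_arr (linial Phi alpha n)) z ->
        complex.Re z = (n * coxeter_number c)%:R / 2%:R].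
Proof.
have [rsPhi _ _] := hPhi.
have ab : labelled_base Phi c alpha by apply: simple_labelled_base.
have [[q0 count] charE] := char_quasiE rsPhi ab hn.
set Q := \prod_(j < l.+1) _.
have char_shift t : char_quasi Phi alpha n t =
    shift_poly Q (fun s : int => s%:~R ^+ l) t.
  by rewrite shift_poly_prod_bracket charE.
have char_P t : char_quasi Phi alpha n t = (poly_shift Q 'X^l).[t%:~R].
  rewrite char_shift poly_shift_horner; congr (shift_poly _ _ _).
  by apply: funext => s; rewrite hornerXn.
split=> //; first by exists (poly_shift Q 'X^l).
have [N charp] := char_poly_arr_prime rsPhi ab n.
have -> : char_poly_arr (linial Phi alpha n) = poly_shift Q 'X^l.
  (* At a large prime both polynomials count the avoiding classes. No congruence on p modulo the
     period arises, because the quasi-polynomial is already known to be a polynomial. *)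
  apply: (@poly_eq_primes _ _ _ (maxn N q0)) => p pr.
  rewrite gtn_max => /andP [Np q0p]; rewrite charp // -count // char_P.
have w0 := ext_coef_gt0 rsPhi ab.
have [_ rootsP] := roots_on_line_bracket n w0 (roots_on_line_Xn R l).
by move=> z /rootsP ->; rewrite add0r.
Qed.
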